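(* (a) Let $d_1=[\widetilde g_\lambda]_{\lambda\in\Lambda}:\bigoplus_{\lambda\in\Lambda}\Sigma^{|g_\lambda|}\mathcal Be_\lambda\to\mathcal Bc_0$ be any of the first rows with $(g_\lambda)=(\operatorname{Sq}^n)$, or $(\operatorname{Sq}^1,\operatorname{Sq}^n)$, or $(\operatorname{Sq}^1,\operatorname{Sq}^2,\operatorname{Sq}^4,\operatorname{Sq}^6,\operatorname{Sq}^8,\dots)$ (the rows of the fiber constructions for $F_n$, $n>0$; $F_{n\mathbb Z}$, $n\ge2$; and $F$). Let $\rho=\sum_{\lambda}a_\lambda e_\lambda$ be a homogeneous primary row syzygy, i.e. $\sum_\lambda a_\lambda g_\lambda=0$ in $\mathcal A$. Then the corrected leftmost tracked reduction $H_\rho=\widehat T\bigl(\sum_\lambda a_\lambda g_\lambda\bigr)$ satisfies $$\partial H_\rho=d_1(\rho)$$ in the pair algebra. Equivalently, $(\rho,H_\rho)$ is a first secondary cycle in the sense of Baues--Jibladze. (b) More generally, suppose the row contains the integral column $e_1$ with $g_1=\operatorname{Sq}^1$, and let $\rho'=\sum_{\lambda\ne1}a_\lambda e_\lambda$ be a homogeneous relation in the nonintegral columns modulo $\mathcal A\operatorname{Sq}^1$, i.e. $\sum_{\lambda\neq1}a_\lambda g_\lambda\in\mathcal A\operatorname{Sq}^1$. Choose any $b_\rho^{\mathrm{can}}\in\mathcal A$ with $\operatorname{Adm}\bigl(\sum_{\lambda\ne1}a_\lambda g_\lambda\bigr)=b_\rho^{\mathrm{can}}\operatorname{Sq}^1$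 (no uniqueness asserted). Then $\widetilde\rho=\rho'+b_\rho^{\mathrm{can}}e_1$ is a homogeneous primary row syzygy, and $H_\rho=\widehat T\bigl(\sum_{\lambda\ne1}a_\lambda g_\lambda\bigr)$ satisfies $$\partial H_\rho=d_1(\widetilde\rho).$$
   Context: $\mathcal A$ is the mod-$2$ Steenrod algebra. A word $\operatorname{Sq}^{a_1}\cdots\operatorname{Sq}^{a_r}$ is admissible if $a_i\ge2a_{i+1}$ for all $i$; admissible words form a basis of $\mathcal A$. For $0<a<2b$ write $[a,b]=\operatorname{Sq}^a\operatorname{Sq}^b+\sum_{k=0}^{\lfloor a/2\rfloor}\binom{b-k-1}{a-2k}\operatorname{Sq}^{a+b-k}\operatorname{Sq}^k$ (binomials mod $2$, $\operatorname{Sq}^0=1$), so $[a,b]=0$ in $\mathcal A$. Pair algebra: $D_1\xrightarrow{\partial}D_0\to\mathcal A$ is Nassau's model at $2$ of Baues's secondary Steenrod algebra $\mathcal B$. $D_0$ (with $\mathbb Z/4$ coefficients) is generated by lifts $\widetilde{\operatorname{Sq}}^a$ of the squares and elements $Y_{k,l}$; $D_1$ is generated by a copy of $\mathcal A$ and elements $\mu_0a$, $U_{k,l}a$, with $\partial(\mu_0a)=2a$ and $\partial(U_{k,l}a)=Y_{k,l}a$. The secondary Adem track $u[a,b]$ (a Baues relation track transported to $D_1$) satisfies $\partial u[a,b]=[a,b]$ and, for words $\alpha,\beta$, $\partial(\alpha u[a,b]\beta)=\alpha[a,b]\beta$. A formal sum of words has the word lift to $D_0$, replacing each $\operatorname{Sq}^{a_1}\cdots\operatorname{Sq}^{a_r}$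 by $\widetilde{\operatorname{Sq}}^{a_1}\cdots\widetilde{\operatorname{Sq}}^{a_r}$; an element in admissible normal form has the admissible lift, the same replacement on its admissible monomials. $\widetilde g_\lambda=\widetilde{\operatorname{Sq}}^a$ when $g_\lambda=\operatorname{Sq}^a$. Equalities in the pair algebra are read in these fixed lifts: word lift for $\sum a_\lambda g_\lambda$, admissible lift for $b_\rho^{\mathrm{can}}\operatorname{Sq}^1$. Tracked Adem reduction: for admissible $w$ set $\operatorname{Adm}(w)=w$, $T(w)=0$. Otherwise let $\operatorname{Sq}^a\operatorname{Sq}^b$ ($0<a<2b$) be the leftmost inadmissible adjacent pair, $w=\alpha\operatorname{Sq}^a\operatorname{Sq}^b\beta$, $w_k=\alpha\operatorname{Sq}^{a+b-k}\operatorname{Sq}^k\beta$, and set $\operatorname{Adm}(w)=\sum_k\operatorname{Adm}(w_k)$, $T(w)=\alpha u[a,b]\beta+\sum_kT(w_k)$, over $0\le k\le\lfloor a/2\rfloor$ with $\binom{b-k-1}{a-2k}$ odd. Extend additively to finite sums. The corrected track is $\widehat T(x)=T(x)+\sum_{a\in C(x)}\mu_0(a)$, with $C(x)$ the finite multiset of lifted $D_0$-monomials $a$ for which the mod-$2$ calculation cancels a duplicate $a+a$. A first secondary cycle for $d_1$ is a pair $(x,\Theta)$ with $x:\Sigma^d\mathcal B\to C_1$ (the source of $d_1$) and a track $\Theta:d_1x\Rightarrow0$; no further equation is required in this degree.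
   Formalization: In (b), the chosen b_ρ^can is required to be homogeneous of degree one less than that of ρ'; for an inhomogeneous choice (e.g. ρ'=0, b=Sq^1+Sq^2Sq^1) the element ρ'+b e_1 is not homogeneous. *)

(* Defs.v *)
From HB Require Import structures.
From mathcomp Require Import all_boot all_order all_algebra finmap.
From mathcomp Require Import monalg.
From mathcomp Require Import boolp functions.
From mathcomp Require Import zify.
Set Implicit Arguments. Unset Strict Implicit. Unset Printing Implicit Defensive.
Import GRing.Theory.
Local Open Scope ring_scope.


(* The indeterminate of index j is the coefficient of x^(j+2) in a power
   series x + sum_j v_j x^(j+2); monomials and polynomials in these
   coefficients are {cmonom nat} and {malg K[{cmonom nat}]}. *)
Notation mon := {cmonom nat}.
Local Notation "m1 ** m2" := (mmul m1 m2) (at level 40, left associativity).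

(* Number of digits 1 in the binary expansion of n. *)
Definition ones (n : nat) : nat := (\sum_(j < n) odd (n %/ 2 ^ j))%N.

Lemma onesEw n N : (n <= N)%N -> ones n = (\sum_(j < N) odd (n %/ 2 ^ j))%N.
Proof.
move=> le; rewrite /ones -!(big_mkord xpredT (fun j => odd (n %/ 2 ^ j) : nat)).
rewrite [RHS](big_cat_nat (n := n)) //= [X in (_ + X)%N]big_nat.
rewrite [X in (_ + X)%N]big1 ?addn0 // => i /andP[ni _]; rewrite divn_small //.
by apply: leq_ltn_trans ni _; apply: ltn_expl.
Qed.

Lemma ones_bit (b : bool) n : ones (b + n.*2) = (b + ones n)%N.
Proof.
rewrite (@onesEw (b + n.*2) (b + n.*2).+1) // (@onesEw n (b + n.*2)); last first.
  by rewrite -addnn addnA leq_addl.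
rewrite big_ord_recl /= expn0 divn1 oddD odd_double addbF oddb; congr (_ + _)%N.
apply: eq_bigr => i _; rewrite /bump /= add1n expnS divnMA.
congr (nat_of_bool (odd (_ %/ _))); clear i; case: b; lia.
Qed.

Lemma ones0 : ones 0 = 0%N. Proof. by rewrite /ones big_ord0. Qed.

Lemma ones_half n : ones n = (odd n + ones n./2)%N.
Proof. by rewrite -[n in LHS]odd_double_half ones_bit. Qed.

Lemma ones_double n : ones n.*2 = ones n.
Proof. by rewrite (ones_bit false). Qed.

Lemma ones1 : ones 1 = 1%N. Proof. by rewrite ones_half ones0. Qed.

Lemma ones_gt0 n : (0 < n)%N -> (0 < ones n)%N.
Proof.
elim/ltn_ind: n => n IH n0; rewrite ones_half addn_gt0.
case: (boolP (odd n)) => //= on; apply: IH; lia.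
Qed.

Lemma onesD a b : (ones (a + b) <= ones a + ones b)%N.
Proof.
have [n] := ubnP (a + b)%N; elim: n a b => // n IH a b le.
have [ab0|ab0] := posnP (a + b); first by rewrite ab0 ones0.
rewrite (ones_half a) (ones_half b) addnACA.
have lt : (a./2 + b./2 < a + b)%N by lia.
have E : (a + b = (odd a + odd b) + (a./2 + b./2).*2)%N by lia.
have IH1 := IH a./2 b./2 ltac:(lia).
case: (odd a) (odd b) E => -[] E; rewrite E; rewrite ?addn0 ?add0n.
- have -> : (true + true + (a./2 + b./2).*2 = (a./2 + b./2 + 1).*2)%N by lia.
  rewrite ones_double; have := IH (a./2 + b./2)%N 1%N ltac:(lia).
  rewrite ones1; lia.
- by rewrite -/(addn _ _) (ones_bit true) leq_add2l.
- by rewrite (ones_bit true) leq_add2l.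
- by rewrite ones_double.
Qed.

Section Divisibility.
Context {R : comNzRingType}.
Implicit Types (x y : R) (g h : {poly R}).

Definition dvd2 k x := exists c, x = c *+ 2 ^ k.

Lemma dvd2_0 k : dvd2 k 0. Proof. by exists 0; rewrite mul0rn. Qed.
Lemma dvd2D k x y : dvd2 k x -> dvd2 k y -> dvd2 k (x + y).
Proof. by move=> [c ->] [d ->]; exists (c + d); rewrite mulrnDl. Qed.
Lemma dvd2N k x : dvd2 k x -> dvd2 k (- x).
Proof. by move=> [c ->]; exists (- c); rewrite mulNrn. Qed.
Lemma dvd2M k l x y : dvd2 k x -> dvd2 l y -> dvd2 (k + l) (x * y).
Proof.
by move=> [c ->] [d ->]; exists (c * d); rewrite mulrnAl mulrnAr -mulrnA -expnD addnC.
Qed.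
Lemma dvd2_le k l x : (k <= l)%N -> dvd2 l x -> dvd2 k x.
Proof.
by move=> kl [c ->]; exists (c *+ 2 ^ (l - k)); rewrite -mulrnA -expnD subnK.
Qed.
Lemma dvd2_sum k I (r : seq I) (P : pred I) F :
  (forall i, P i -> dvd2 k (F i)) -> dvd2 k (\sum_(i <- r | P i) F i).
Proof. by move=> h; apply: big_ind => //; [exact: dvd2_0 | exact: dvd2D]. Qed.
Lemma dvd20 x : dvd2 0 x. Proof. by exists x. Qed.

(* filt 1 g says that the coefficient of x^e in g is divisible by
   2^(ones e - 1); this condition is stable under composition. *)
Definition filt r g := forall e, dvd2 (ones e - r) g`_e.

Lemma filtM r s g h : filt r g -> filt s h -> filt (r + s) (g * h).
Proof.
move=> fg fh e; rewrite coefM; apply: dvd2_sum => -[i /=].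
rewrite ltnS => ie _; apply: dvd2_le (dvd2M (fg i) (fh (e - i)%N)).
by have := onesD i (e - i); rewrite subnKC //; lia.
Qed.

Lemma filtD r g h : filt r g -> filt r h -> filt r (g + h).
Proof. by move=> fg fh e; rewrite coefD; apply: dvd2D. Qed.

Lemma filt_sqr g : filt 1 g -> filt 1 (g ^+ 2).
Proof.
move=> fg; suff H n : filt 1 (\sum_(i < n) g`_i *: 'X^i) /\
                      filt 1 ((\sum_(i < n) g`_i *: 'X^i) ^+ 2).
  by have [_] := H (size g); rewrite -poly_def coefK.
elim: n => [|n [IH1 IH2]].
  by rewrite big_ord0 expr0n /=; split => e; rewrite coef0; exact: dvd2_0.
rewrite big_ord_recr /=; set h := \sum_(i < n) _ in IH1 IH2 *.
have f1 : filt 1 (g`_n *: 'X^n).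
  by move=> e; rewrite coefZ coefXn; case: eqP => [->|_];
     rewrite ?mulr1 ?mulr0 //; exact: dvd2_0.
split; first exact: filtD.
rewrite sqrrD; apply: filtD; first apply: filtD => //.
  move=> e; rewrite coefMn -scalerAr coefZ coefMXn.
  case: ltnP => en; first by rewrite mulr0 mul0rn; exact: dvd2_0.
  have -> : g`_n * h`_(e - n) *+ 2 = (1 *+ 2 ^ 1) * (g`_n * h`_(e - n)).
    by rewrite mulrnAl mul1r.
  apply: dvd2_le (dvd2M _ (dvd2M (fg n) (IH1 (e - n)%N))); last by exists 1.
  by have := onesD n (e - n); rewrite subnKC //; lia.
move=> e; rewrite exprZn -exprM coefZ coefXn; case: eqP => [->|_]; last first.
  by rewrite mulr0; exact: dvd2_0.
rewrite mulr1 muln2 ones_double expr2.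
by apply: dvd2_le (dvd2M (fg n) (fg n)); lia.
Qed.

Lemma filtX j g : filt 1 g -> filt (ones j) (g ^+ j).
Proof.
elim/ltn_ind: j g => j IH g fg; have [->|j0] := posnP j.
  by move=> e; rewrite expr0 coef1; case: e => [|e]; rewrite ?ones0;
     [exact: dvd20 | exact: dvd2_0].
have E : g ^+ j = g ^+ odd j * (g ^+ 2) ^+ j./2.
  by rewrite -exprM -exprD mul2n odd_double_half.
rewrite E ones_half; apply: filtM; last by apply: IH; [lia | exact: filt_sqr].
case: (odd j) => //= e; rewrite ?expr1 //.
by rewrite expr0 coef1; case: e => [|e]; rewrite ?ones0;
   [exact: dvd20 | exact: dvd2_0].
Qed.

Lemma filt_comp (p g : {poly R}) :
  p`_0 = 0 -> filt 1 p -> filt 1 g -> filt 1 (p \Po g).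
Proof.
move=> p0 fp fg e; rewrite coef_comp_poly; apply: dvd2_sum => -[[|i] /= _] _.
  by rewrite p0 mul0r; exact: dvd2_0.
apply: dvd2_le (dvd2M (fp _) (filtX i.+1 fg e)).
by have := @ones_gt0 i.+1 isT; lia.
Qed.
End Divisibility.

Section Series.
Context {R : comNzRingType}.
Implicit Types (v w : nat -> R) (p q : {poly R}).

Definition scoef v (i : nat) : R :=
  match i with 0 => 0 | 1 => 1 | j.+2 => v j end.

(* x + sum_j v_j x^(j+2), truncated after degree n *)
Definition series v (n : nat) : {poly R} := \poly_(i < n.+1) scoef v i.

(* Coefficients of the composite W(V(x)), where V and W are the series with
   coefficients v and w; terms of degree > j.+2 do not contribute. *)
Definition scomp v w (j : nat) : R :=
  (series w j.+2 \Po series v j.+2)`_j.+2.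

Lemma series0 v n : (series v n)`_0 = 0. Proof. by rewrite coef_poly. Qed.

Lemma comp_low_coef p q i : q`_0 = 0 ->
  (p \Po q)`_i = \sum_(j < i.+1) p`_j * (q ^+ j)`_i.
Proof.
move=> q0; have zero j : (i < j)%N -> (q ^+ j)`_i = 0.
  elim: j i => // j IH i; rewrite ltnS => ij; rewrite exprS coefM.
  apply: big1 => -[[|k] /= hk] _; first by rewrite q0 mul0r.
  by rewrite IH ?mulr0 //; lia.
rewrite coef_comp_poly.
pose F j := p`_j * (q ^+ j)`_i.
rewrite -(big_mkord xpredT F) -[RHS](big_mkord xpredT F).
have [le|lt] := leqP (size p) i.+1.
  rewrite [RHS](big_cat_nat (n := size p)) //= [X in _ = _ + X]big_nat.
  by rewrite [X in _ = _ + X]big1 ?addr0 // => j /andP[h _]; rewrite /F nth_default ?mul0r.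
rewrite [LHS](big_cat_nat (n := i.+1)) ?(ltnW lt) //= [X in _ + X]big_nat.
by rewrite [X in _ + X]big1 ?addr0 // => j /andP[h _]; rewrite /F zero ?mulr0.
Qed.

Definition eqlow n p q := forall i, (i <= n)%N -> p`_i = q`_i.

Lemma eqlowM n p p' q q' :
  eqlow n p p' -> eqlow n q q' -> eqlow n (p * q) (p' * q').
Proof.
move=> h1 h2 i hi; rewrite !coefM; apply: eq_bigr => -[j hj] _ /=.
by rewrite h1 ?h2 //; lia.
Qed.

Lemma eqlowX n q q' j : eqlow n q q' -> eqlow n (q ^+ j) (q' ^+ j).
Proof. by move=> h; elim: j => // j IH; rewrite !exprS; apply: eqlowM. Qed.

Lemma eqlow_comp n p p' q q' : q`_0 = 0 ->
  eqlow n p p' -> eqlow n q q' -> eqlow n (p \Po q) (p' \Po q').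
Proof.
move=> q0 h1 h2 i hi; have q0' : q'`_0 = 0 by rewrite -h2.
rewrite !comp_low_coef //; apply: eq_bigr => -[j hj] _ /=.
by rewrite h1 ?(eqlowX j h2) //; lia.
Qed.

Lemma eqlow_series v n N : (n <= N)%N -> eqlow n (series v n) (series v N).
Proof. by move=> h i hi; rewrite !coef_poly !ltnS hi (leq_trans hi h). Qed.

Lemma eqlow_scomp v w n :
  eqlow n (series (scomp v w) n) (series w n \Po series v n).
Proof.
move=> i hi; rewrite coef_poly ltnS hi; case: i hi => [|[|i]] hi /=.
- rewrite comp_low_coef ?series0 // big_ord1 series0 mul0r //.
- rewrite comp_low_coef ?series0 // !big_ord_recl big_ord0 series0 mul0r add0r.
  by rewrite expr1 !coef_poly /bump /= !ltnS hi mul1r addr0.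
rewrite /scomp; apply: (@eqlow_comp i.+2) => //; first exact: series0.
  exact: eqlow_series.
exact: eqlow_series.
Qed.

Lemma scompA v1 v2 v3 : scomp (scomp v1 v2) v3 =1 scomp v1 (scomp v2 v3).
Proof.
move=> j; rewrite /scomp.
transitivity ((series v3 j.+2 \Po (series v2 j.+2 \Po series v1 j.+2))`_j.+2).
  apply: (@eqlow_comp j.+2) => //; first exact: series0.
  exact: eqlow_scomp.
rewrite comp_polyA; apply: (@eqlow_comp j.+2) => //; first exact: series0.
by move=> i hi; rewrite eqlow_scomp.
Qed.

Lemma eq_scomp v v' w w' : v =1 v' -> w =1 w' -> scomp v w =1 scomp v' w'.
Proof.
move=> h1 h2 j; rewrite /scomp; congr ((_ \Po _)`_ _);
by apply/polyP => i; rewrite !coef_poly; case: ifP => // _; case: i => [|[|i]] /=.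
Qed.

Lemma series_0 n : (0 < n)%N -> series (fun=> 0) n = 'X.
Proof.
by move=> n0; apply/polyP => -[|[|i]]; rewrite coef_poly coefX //= ?ltnS ?n0 ?if_same.
Qed.

Lemma scomp0l w : scomp (fun=> 0) w =1 w.
Proof.
by move=> j; rewrite /scomp series_0 // comp_polyXr coef_poly ltnS leqnn.
Qed.

Lemma scomp0r v : scomp v (fun=> 0) =1 v.
Proof.
by move=> j; rewrite /scomp series_0 // comp_polyX coef_poly ltnS leqnn.
Qed.
End Series.

Lemma rmorph_scomp (R S : comNzRingType) (f : {rmorphism R -> S}) v w j :
  f (scomp v w j) = scomp (f \o v) (f \o w) j.
Proof.
rewrite /scomp -coef_map map_comp_poly; congr ((_ \Po _)`_ _);
by apply/polyP => i; rewrite coef_map !coef_poly; case: ifP => _; rewrite ?rmorph0 //;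
   case: i => [|[|i]] /=; rewrite ?rmorph0 ?rmorph1.
Qed.

Section Weights.
Definition wgt (c : nat -> nat) (m : mon) : nat :=
  (\sum_(i <- finsupp m) m i * c i)%N.

Lemma wgtEw c (m : mon) (d : {fset nat}) : (finsupp m `<=` d)%fset ->
  wgt c m = (\sum_(i <- d) m i * c i)%N.
Proof.
move=> le; rewrite /wgt (big_fset_incl _ le) // => i _.
by rewrite -cmE_eq0 => /eqP ->.
Qed.

Lemma wgt1 c : wgt c mone = 0%N.
Proof. by rewrite /wgt mdom1 big_seq_fset0. Qed.

Lemma wgtM c m1 m2 : wgt c (m1 ** m2) = (wgt c m1 + wgt c m2)%N.
Proof.
rewrite (@wgtEw c m1 (finsupp m1 `|` finsupp m2)%fset) ?fsubsetUl //.
rewrite (@wgtEw c m2 (finsupp m1 `|` finsupp m2)%fset) ?fsubsetUr //.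
rewrite (@wgtEw c (m1 ** m2) (finsupp m1 `|` finsupp m2)%fset) ?mdomD //.
by rewrite -big_split; apply: eq_bigr => i _; rewrite cmM mulnDl.
Qed.

Lemma wgtU c i : wgt c (ucm i) = c i.
Proof. by rewrite /wgt mdomU big_seq_fset1 cmUU mul1n. Qed.

(* The coefficient of x^(j+2) has degree j+1.  Over Z/4, the factor
   2^(ones e - 1) in front of the coefficient of x^e leaves exactly the
   coefficients xi_k of x^(2^k) and 2 xi_{k,l} of x^(2^k + 2^l), k < l;
   ht m is the resulting power of 2 in front of the monomial m. *)
Definition deg := wgt succn.
Definition ht := wgt (fun i => (ones i.+2).-1).
End Weights.

Section Eval.
Context {R : comNzRingType}.

Definition mev (v : nat -> R) (m : mon) : R := \prod_(i <- finsupp m) v i ^+ m i.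

Lemma mevEw v (m : mon) (d : {fset nat}) : (finsupp m `<=` d)%fset ->
  mev v m = \prod_(i <- d) v i ^+ m i.
Proof.
move=> le; rewrite /mev (big_fset_incl _ le) // => i _.
by rewrite -cmE_eq0 => /eqP ->.
Qed.

Lemma mev_is_mmorphism v : mmorphism (mev v).
Proof.
split=> [m1 m2|]; last by rewrite /mev mdom1 big_seq_fset0.
rewrite (@mevEw v m1 (finsupp m1 `|` finsupp m2)%fset) ?fsubsetUl //.
rewrite (@mevEw v m2 (finsupp m1 `|` finsupp m2)%fset) ?fsubsetUr //.
rewrite (@mevEw v (m1 ** m2) (finsupp m1 `|` finsupp m2)%fset) ?mdomD //.
by rewrite -big_split; apply: eq_bigr => i _; rewrite cmM exprD.
Qed.

HB.instance Definition _ v := isMultiplicative.Build mon R (mev v)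
  (mev_is_mmorphism v).

Lemma mev1 v : mev v mone = 1. Proof. by case: (mev_is_mmorphism v). Qed.
Lemma mevM v m1 m2 : mev v (m1 ** m2) = mev v m1 * mev v m2.
Proof. by case: (mev_is_mmorphism v). Qed.

Lemma mevU v i : mev v (ucm i) = v i.
Proof. by rewrite /mev mdomU big_seq_fset1 cmUU expr1. Qed.

Lemma eq_mev v v' : v =1 v' -> mev v =1 mev v'.
Proof. by move=> h m; apply: eq_bigr => i _; rewrite h. Qed.
End Eval.

Lemma rmorph_mev (R S : comNzRingType) (f : {rmorphism R -> S}) v m :
  f (mev v m) = mev (f \o v) m.
Proof. by rewrite rmorph_prod; apply: eq_bigr => i _; rewrite rmorphXn. Qed.

Section Gen.
Context {R : comNzRingType}.
Definition gen (j : nat) : {malg R[mon]} := << ucm j >>.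

Lemma mulUU (a b : mon) : << a >> * << b >> = << (a ** b) >> :> {malg R[mon]}.
Proof. by rewrite malgM_def fgmulUU mulr1. Qed.

Lemma mon_ind (P : mon -> Prop) :
  P mone -> (forall i m, P m -> P (ucm i ** m)) -> forall m, P m.
Proof.
move=> P1 PS m; have [n] := ubnP (mdeg m); elim: n m => // n IH m.
have [/eqP|m0] := posnP (mdeg m); first by rewrite mdeg_eq0 => /eqP -> _.
have [i im] : exists i, i \in finsupp m.
  apply/fset0Pn; apply: contraTneq m0 => h.
  by rewrite /mdeg h big_seq_fset0.
have E : m = ucm i ** divcm m (ucm i).
  apply/eqP/cmP => j; rewrite cmM divcmE cmU.
  by case: eqP => [<-|_] //=; rewrite ?subn0 // subnKC // lt0n cmE_neq0.
move=> h; rewrite E; apply: PS; apply: IH; move: h.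
by rewrite {1}E mdegM mdegU add1n ltnS.
Qed.

Lemma mev_gen (m : mon) : mev gen m = << m >>.
Proof.
elim/mon_ind: m => [|i m IH]; first by rewrite mev1.
by rewrite mevM IH mevU; exact: mulUU.
Qed.

Lemma malg_split (q : {malg R[mon]}) :
  q = \sum_(m <- msupp q) (q@_m)%:MP * << m >>.
Proof.
rewrite {1}(monalgE q); apply: eq_bigr => m _.
by rewrite malgM_def fgmulUU mulr1 mul1m.
Qed.

Lemma eq_rmorph_malg (S : comNzRingType) (f g : {rmorphism {malg R[mon]} -> S}) :
  (forall c, f c%:MP = g c%:MP) -> (forall j, f (gen j) = g (gen j)) -> f =1 g.
Proof.
move=> hc hg q; rewrite (malg_split q).
have E (h : {rmorphism {malg R[mon]} -> S}) m : h << m >> = mev (h \o gen) m.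
  by rewrite -(rmorph_mev h) mev_gen.
rewrite !rmorph_sum; apply: eq_bigr => m _.
transitivity (f (q@_m)%:MP * f << m >>); first exact: rmorphM.
transitivity (g (q@_m)%:MP * g << m >>); last by rewrite [RHS]rmorphM.
congr (_ * _); first exact: hc.
by rewrite (E f) (E g); apply: eq_mev => j; apply: hg.
Qed.

Lemma eq_additive_malg (S : zmodType) (f g : {additive {malg R[mon]} -> S}) :
  (forall c m, f << c *g m >> = g << c *g m >>) -> f =1 g.
Proof.
move=> h q; rewrite (monalgE q) !raddf_sum.
by apply: eq_bigr => m _; apply: h.
Qed.
End Gen.

Section Grading.
Context {R : comNzRingType} (H : nat -> R -> Prop).

Record grading_axioms : Prop := Grading {
  grd0 : forall d, H d 0;
  grdD : forall d x y, H d x -> H d y -> H d (x + y);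
  grd1 : H 0%N 1;
  grdM : forall d e x y, H d x -> H e y -> H (d + e)%N (x * y) }.

Hypothesis HG : grading_axioms.

Definition grd n j x := x = 0 \/ ((j <= n)%N /\ H (n - j)%N x).

Lemma grd_0 n j : grd n j 0. Proof. by left. Qed.

Lemma grd_H n j x : grd n j x -> H (n - j) x.
Proof. by case=> [->|[]] //; apply: grd0 HG _. Qed.

Lemma grd_D n j x y : grd n j x -> grd n j y -> grd n j (x + y).
Proof.
case=> [->|[h1 h2]]; first by rewrite add0r.
case=> [->|[_ h3]]; first by rewrite addr0; right.
by right; split=> //; apply: (grdD HG).
Qed.

Lemma grd_M n j n' j' x y :
  grd n j x -> grd n' j' y -> grd (n + n') (j + j') (x * y).
Proof.
case=> [->|[h1 h2]]; first by rewrite mul0r; left.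
case=> [->|[h3 h4]]; first by rewrite mulr0; left.
right; split; first exact: leq_add.
have -> : (n + n' - (j + j') = (n - j) + (n' - j'))%N by lia.
exact: (grdM HG).
Qed.

Lemma grd_sum n j I (r : seq I) (P : pred I) F :
  (forall i, P i -> grd n j (F i)) -> grd n j (\sum_(i <- r | P i) F i).
Proof. by move=> h; apply: big_ind => //; [exact: grd_0 | exact: grd_D]. Qed.

Lemma grd_poly j j' (g h : {poly R}) :
  (forall i, grd i j g`_i) -> (forall i, grd i j' h`_i) ->
  forall i, grd i (j + j') (g * h)`_i.
Proof.
move=> h1 h2 i; rewrite coefM; apply: grd_sum => -[k /= hk] _.
by rewrite -{1}(@subnKC k i) //; apply: grd_M.
Qed.

Lemma grd_series v n : (forall j, H j.+1 (v j)) ->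
  forall i, grd i 1 (series v n)`_i.
Proof.
move=> hv i; rewrite coef_poly; case: ifP => _; last exact: grd_0.
case: i => [|[|i]] /=; first exact: grd_0.
  by right; split => //; apply: (grd1 HG).
by right; rewrite subn1 /=.
Qed.

Lemma grd_exp (g : {poly R}) j : (forall i, grd i 1 g`_i) ->
  forall i, grd i j (g ^+ j)`_i.
Proof.
move=> hg; elim: j => [|j IH] i.
  rewrite expr0 coef1; case: i => [|i] /=; last exact: grd_0.
  by right; split=> //; apply: (grd1 HG).
by rewrite exprS -add1n; apply: grd_poly.
Qed.

Lemma grd_scomp v w : (forall j, H j.+1 (v j)) -> (forall j, H j.+1 (w j)) ->
  forall j, H j.+1 (scomp v w j).
Proof.
move=> hv hw j; rewrite /scomp coef_comp_poly.
set s := \sum_(i < _) _; suff : grd j.+2 1 s by move/grd_H; rewrite subn1.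
apply: grd_sum => -[i /= _] _.
have := grd_M (grd_series j.+2 hw i) (grd_exp i (grd_series j.+2 hv) j.+2).
case=> [->|[h1 h2]]; first exact: grd_0.
right; split => //.
by have -> : (j.+2 - 1 = i + j.+2 - (1 + i))%N by lia.
Qed.

Lemma grd_mev v m : (forall j, H j.+1 (v j)) -> H (deg m) (mev v m).
Proof.
move=> hv; elim/mon_ind: m => [|i m IH].
  by rewrite mev1 /deg wgt1; apply: (grd1 HG).
by rewrite mevM /deg wgtM wgtU /= mevU; apply: (grdM HG).
Qed.
End Grading.

Section GradingMalg.
Context {R : comNzRingType} (H : nat -> R -> Prop) (HG : grading_axioms H).

Definition gmalg d (q : {malg R[mon]}) := forall m, grd H d (deg m) q@_m.

Lemma gmalg_axioms : grading_axioms gmalg.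
Proof.
split.
- by move=> d m; rewrite mcoeff0; exact: grd_0.
- by move=> d x y hx hy m; rewrite mcoeffD; exact: grd_D.
- move=> m; rewrite mcoeff1; case: eqP => [->|_]; last exact: grd_0.
  by right; rewrite /deg wgt1; split=> //; apply: (grd1 HG).
move=> d e x y hx hy m; rewrite mcoeffMl.
apply: grd_sum => // m1 _; apply: grd_sum => // m2 _.
case: eqP => [<-|_]; last by rewrite mulr0n; exact: grd_0.
by rewrite mulr1n /deg wgtM; apply: grd_M.
Qed.

Lemma gmalg_gen j : gmalg j.+1 (gen j).
Proof.
move=> m; rewrite /gen mcoeffU1; case: eqP => [<-|_]; last exact: grd_0.
by right; rewrite /deg wgtU; split=> //; rewrite subnn; apply: (grd1 HG).
Qed.

Lemma gmalg_C d c : H d c -> gmalg d c%:MP.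
Proof.
move=> hc m; rewrite mcoeffC; case: eqP => [->|_]; last exact: grd_0.
by right; rewrite /deg wgt1 subn0.
Qed.
End GradingMalg.

Lemma CmulU (R : comNzRingType) (c d : R) (m : mon) :
  c%:MP * << d *g m >> = << c * d *g m >> :> {malg R[mon]}.
Proof. by rewrite malgM_def fgmulUU mul1m. Qed.

Lemma CmulU1 (R : comNzRingType) (c : R) (m : mon) :
  c%:MP * << m >> = << c *g m >> :> {malg R[mon]}.
Proof. by rewrite CmulU mulr1. Qed.

HB.lock Definition subst (R S : comNzRingType) (f : {rmorphism R -> S})
  (v : nat -> S) (p : {malg R[mon]}) : S := mmap f (mev v) p.

Section Subst.
Context {R S : comNzRingType} (f : {rmorphism R -> S}) (v : nat -> S).

Lemma subst_zmod : additive (subst f v).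
Proof. by move=> p q; rewrite subst.unlock raddfB. Qed.
Lemma subst_mul : multiplicative (subst f v).
Proof. by rewrite subst.unlock; split=> [p q|]; rewrite ?rmorphM ?rmorph1. Qed.
HB.instance Definition _ :=
  GRing.isAdditive.Build {malg R[mon]} S (subst f v) subst_zmod.
HB.instance Definition _ :=
  GRing.isMultiplicative.Build {malg R[mon]} S (subst f v) subst_mul.

Lemma substU c m : subst f v << c *g m >> = f c * mev v m.
Proof. by rewrite subst.unlock; exact: mmapU. Qed.
Lemma substC c : subst f v c%:MP = f c.
Proof. by rewrite substU mev1 mulr1. Qed.
Lemma subst_gen j : subst f v (gen j) = v j.
Proof. by rewrite substU rmorph1 mul1r mevU. Qed.
End Subst.

(* Coproduct of the indeterminates, read off from the composition of power
   series; the left tensor factor (the inner series) sits in the coefficients,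
   the right one (the outer series) in the monomials. *)
Definition cop_gen (K : comNzRingType) : nat -> {malg {malg K[mon]}[mon]} :=
  scomp (fun j => (gen j)%:MP) gen.

HB.lock Definition ev (K : comNzRingType) (s : mon -> K) (p : {malg K[mon]}) : K :=
  \sum_(m <- msupp p) p@_m * s m.

HB.lock Definition ev2 (K : comNzRingType) (s t : mon -> K)
  (q : {malg {malg K[mon]}[mon]}) : K := \sum_(m <- msupp q) ev s q@_m * t m.

(* Convolution product of functionals: <s * t, m> = <s (x) t, coproduct of m>. *)
HB.lock Definition conv (K : comNzRingType) (s t : mon -> K) (m : mon) : K :=
  ev2 s t (mev (cop_gen K) m).

HB.lock Definition ev3 (K : comNzRingType) (s t u : mon -> K)
  (q : {malg {malg {malg K[mon]}[mon]}[mon]}) : K :=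
  \sum_(m <- msupp q) ev2 s t q@_m * u m.

Section Functionals.
Context {K : comNzRingType}.
Local Notation P1 := {malg K[mon]}.
Local Notation P2 := {malg P1[mon]}.
Local Notation P3 := {malg P2[mon]}.
Implicit Types (s t u : mon -> K).

Lemma ev_additive s : additive (ev s).
Proof. by rewrite ev.unlock; exact: (raddfB (mmap idfun s)). Qed.
HB.instance Definition _ s := GRing.isAdditive.Build P1 K (ev s) (ev_additive s).

Lemma ev2_additive s t : additive (ev2 s t).
Proof. by rewrite ev2.unlock; exact: (raddfB (mmap (ev s) t)). Qed.
HB.instance Definition _ s t :=
  GRing.isAdditive.Build P2 K (ev2 s t) (ev2_additive s t).

Lemma ev3_additive s t u : additive (ev3 s t u).
Proof. by rewrite ev3.unlock; exact: (raddfB (mmap (ev2 s t) u)). Qed.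
HB.instance Definition _ s t u :=
  GRing.isAdditive.Build P3 K (ev3 s t u) (ev3_additive s t u).

Lemma evU s c m : ev s << c *g m >> = c * s m.
Proof. by rewrite ev.unlock; exact: (@mmapU _ _ _ idfun). Qed.
Lemma ev2U s t p m : ev2 s t << p *g m >> = ev s p * t m.
Proof. by rewrite ev2.unlock; exact: (@mmapU _ _ _ (ev s)). Qed.
Lemma ev3U s t u p m : ev3 s t u << p *g m >> = ev2 s t p * u m.
Proof. by rewrite ev3.unlock; exact: (@mmapU _ _ _ (ev2 s t)). Qed.

Lemma evZ s c p : ev s (c%:MP * p) = c * ev s p.
Proof.
rewrite (monalgE p) mulr_sumr !raddf_sum mulr_sumr; apply: eq_bigr => m _ /=.
by rewrite CmulU [LHS]evU -mulrA; congr (_ * _); apply/esym/evU.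
Qed.

Lemma ev2Z s t c q : ev2 s t (c%:MP%:MP * q) = c * ev2 s t q.
Proof.
rewrite (monalgE q) mulr_sumr !raddf_sum mulr_sumr; apply: eq_bigr => m _ /=.
by rewrite CmulU [LHS]ev2U evZ -mulrA; congr (_ * _); apply/esym/ev2U.
Qed.

Let CC := (malgC \o malgC : {rmorphism K -> P2}).
Let CC3 := (malgC \o malgC : {rmorphism P1 -> P3}).
Let copP : {rmorphism P1 -> P2} := subst CC (cop_gen K).
Let copL : {rmorphism P2 -> P3} := subst (malgC \o copP) gen.
Let g23 : nat -> P3 := scomp (fun j => (gen j : P2)%:MP) gen.
Let copR : {rmorphism P2 -> P3} := subst CC3 g23.
Let inj2 : {rmorphism P1 -> P2} := subst CC gen.
Let inj23 : {rmorphism P2 -> P3} := subst (malgC \o inj2) gen.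

Lemma copPU c m : copP << c *g m >> = c%:MP%:MP * mev (cop_gen K) m.
Proof. exact: substU. Qed.
Lemma copLU p m : copL << p *g m >> = << copP p *g m >>.
Proof. by rewrite /copL /= substU mev_gen /= CmulU1. Qed.
Lemma copRU p m : copR << p *g m >> = p%:MP%:MP * mev g23 m.
Proof. exact: substU. Qed.
Lemma inj2U c m : inj2 << c *g m >> = << c%:MP *g m >>.
Proof. by rewrite /inj2 /= substU mev_gen /= CmulU1. Qed.
Lemma inj23U p m : inj23 << p *g m >> = << inj2 p *g m >>.
Proof. by rewrite /inj23 /= substU mev_gen /= CmulU1. Qed.

Lemma convE s t m : conv s t m = ev2 s t (copP << m >>).
Proof. by rewrite conv.unlock copPU !rmorph1 mul1r. Qed.

Lemma ev_conv s t p : ev (conv s t) p = ev2 s t (copP p).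
Proof.
rewrite (monalgE p) !raddf_sum; apply: eq_bigr => m _ /=.
by rewrite [LHS]evU conv.unlock copPU [RHS]ev2Z.
Qed.

Lemma ev2_convl s t u q : ev2 (conv s t) u q = ev3 s t u (copL q).
Proof.
rewrite (monalgE q) !raddf_sum; apply: eq_bigr => m _ /=.
by rewrite [LHS]ev2U copLU [RHS]ev3U ev_conv.
Qed.

Lemma ev2_inj2 s t p q : ev2 s t (p%:MP * inj2 q) = ev s p * ev t q.
Proof.
rewrite (monalgE q) [inj2 _]raddf_sum mulr_sumr !raddf_sum mulr_sumr.
apply: eq_bigr => m _ /=.
rewrite inj2U CmulU [LHS]ev2U [p * _]mulrC evZ [X in X * _]mulrC -mulrA.
by congr (_ * _); apply/esym/evU.
Qed.

Lemma ev3_inj23 s t u p q :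
  ev3 s t u (p%:MP%:MP * inj23 q) = ev s p * ev2 t u q.
Proof.
rewrite (monalgE q) [inj23 _]raddf_sum mulr_sumr !raddf_sum mulr_sumr.
apply: eq_bigr => m _ /=.
rewrite inj23U CmulU [LHS]ev3U ev2_inj2 -mulrA.
by congr (_ * _); apply/esym/ev2U.
Qed.

Lemma inj23_cop m : inj23 (mev (cop_gen K) m) = mev g23 m.
Proof.
rewrite rmorph_mev; apply: eq_mev => j /=; rewrite /cop_gen rmorph_scomp.
apply: eq_scomp => i /=; last exact: subst_gen.
by rewrite /inj23 /= substC /= /inj2 /= subst_gen.
Qed.

Lemma ev2_convr s t u q : ev2 s (conv t u) q = ev3 s t u (copR q).
Proof.
rewrite (monalgE q) !raddf_sum; apply: eq_bigr => m _ /=.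
by rewrite [LHS]ev2U copRU -inj23_cop [RHS]ev3_inj23 conv.unlock.
Qed.

Lemma coassoc p : copL (copP p) = copR (copP p).
Proof.
apply: (@eq_rmorph_malg _ _ (copL \o copP) (copR \o copP)) => [c|j] /=.
  by rewrite /copP /= substC /= /copL /copR /= !substC /= /copP /= substC.
have -> : copP (gen j) = cop_gen K j by exact: subst_gen.
rewrite /cop_gen !rmorph_scomp.
transitivity (scomp (fun i => (cop_gen K i)%:MP) gen j : P3).
  apply: eq_scomp => i /=; last exact: subst_gen.
  by rewrite /copL /= substC /= /copP /= subst_gen.
transitivity (scomp (fun i => (gen i)%:MP%:MP) g23 j : P3); last first.
  apply: eq_scomp => i /=; last by rewrite /copR subst_gen.
  by rewrite /copR /= substC.
apply: etrans (scompA _ _ _ j).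
by apply: eq_scomp => // i; exact: (rmorph_scomp malgC).
Qed.

Lemma convA s t u : conv s (conv t u) =1 conv (conv s t) u.
Proof. by move=> m; rewrite !convE ev2_convl ev2_convr coassoc. Qed.

Definition fone : mon -> K := fun m => (m == mone)%:R.

Lemma ev_fone p : ev fone p = p@_mone.
Proof.
rewrite (monalgE p) !raddf_sum; apply: eq_bigr => m _ /=.
rewrite [LHS]evU [RHS]mcoeffU /fone.
by case: eqP => _; rewrite ?mulr1 ?mulr0.
Qed.

Let eps : {rmorphism P1 -> K} := mcoeff mone.
Let epsL : {rmorphism P2 -> P1} := subst (malgC \o eps) gen.
Let epsR : {rmorphism P2 -> P1} := mcoeff mone.

Lemma eps_gen j : eps (gen j) = 0.
Proof. by rewrite [LHS]mcoeffU1 cm1_eq1. Qed.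

Lemma ev2_fonel s q : ev2 fone s q = ev s (epsL q).
Proof.
rewrite (monalgE q) !raddf_sum; apply: eq_bigr => m _ /=.
by rewrite [LHS]ev2U ev_fone /epsL /= substU mev_gen /= CmulU1 [RHS]evU.
Qed.

Lemma ev2_foner s q : ev2 s fone q = ev s (epsR q).
Proof.
rewrite (monalgE q) !raddf_sum; apply: eq_bigr => m _ /=.
rewrite [LHS]ev2U /epsR /= [in RHS]mcoeffU /fone.
by case: eqP => _; rewrite ?mulr1 // mulr0 mulr0n raddf0.
Qed.

Lemma epsL_cop p : epsL (copP p) = p.
Proof.
apply: (@eq_rmorph_malg _ _ (epsL \o copP) idfun) => [c|j] /=.
  by rewrite /copP /= substC /= /epsL /= substC /= /eps /= malgCK.
have -> : copP (gen j) = cop_gen K j by exact: subst_gen.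
rewrite /cop_gen rmorph_scomp.
apply: etrans (scomp0l _ j); apply: eq_scomp => i /=; last exact: subst_gen.
by rewrite /epsL /= substC /= eps_gen raddf0.
Qed.

Lemma epsR_cop p : epsR (copP p) = p.
Proof.
apply: (@eq_rmorph_malg _ _ (epsR \o copP) idfun) => [c|j] /=.
  by rewrite /copP /= substC /= /epsR /= malgCK.
have -> : copP (gen j) = cop_gen K j by exact: subst_gen.
rewrite /cop_gen rmorph_scomp.
apply: etrans (scomp0r _ j); apply: eq_scomp => i /=; first exact: malgCK.
by rewrite /epsR [LHS]mcoeffU1 cm1_eq1.
Qed.

Lemma conv1f s : conv fone s =1 s.
Proof. by move=> m; rewrite convE ev2_fonel epsL_cop evU mul1r. Qed.

Lemma convf1 s : conv s fone =1 s.
Proof. by move=> m; rewrite convE ev2_foner epsR_cop evU mul1r. Qed.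

Lemma evE s p : ev s p = \sum_(m <- msupp p) p@_m * s m.
Proof. by rewrite ev.unlock. Qed.
Lemma ev2E s t q : ev2 s t q = \sum_(m <- msupp q) ev s q@_m * t m.
Proof. by rewrite ev2.unlock. Qed.

Lemma convDl s s' t m :
  conv (fun i => s i + s' i) t m = conv s t m + conv s' t m.
Proof.
rewrite conv.unlock !ev2E -big_split; apply: eq_bigr => i _ /=.
rewrite -mulrDl !evE -big_split; congr (_ * _); apply: eq_bigr => k _ /=.
by rewrite mulrDr.
Qed.

Lemma convDr s t t' m :
  conv s (fun i => t i + t' i) m = conv s t m + conv s t' m.
Proof.
rewrite conv.unlock !ev2E -big_split; apply: eq_bigr => i _ /=.
by rewrite mulrDr.
Qed.

Lemma conv0f t m : conv (fun=> 0) t m = 0.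
Proof.
rewrite conv.unlock ev2E big1 // => i _.
by rewrite evE big1 ?mul0r // => k _; rewrite mulr0.
Qed.

Definition gK d (x : K) := x = 0 \/ d = 0%N.

Lemma gK_axioms : grading_axioms gK.
Proof.
split; first by left.
- by move=> d x y [->|h] [->|h']; rewrite ?addr0; [left|right|right|right].
- by right.
by move=> d e x y [->|h] [->|h']; rewrite ?mul0r ?mulr0; [left|left|left|right; rewrite h h'].
Qed.

Lemma conv_support s t m : conv s t m != 0 ->
  exists m1 m2, [/\ (deg m1 + deg m2 = deg m)%N, s m1 != 0 & t m2 != 0].
Proof.
have gP1 := gmalg_axioms gK_axioms; have gP2 := gmalg_axioms gP1.
have hm : gmalg (gmalg gK) (deg m) (mev (cop_gen K) m).
  apply: (grd_mev gP2) => j; apply: (grd_scomp gP2) => i.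
    by apply: gmalg_C => //; exact: (gmalg_gen gK_axioms).
  exact: (gmalg_gen gP1).
rewrite conv.unlock ev2E; set q := mev _ _ in hm *; move=> nz.
have [m2 _ n2] : exists2 m2, m2 \in msupp q & ev s q@_m2 * t m2 != 0.
  apply/hasP; apply: contraNT nz => /hasPn h.
  by rewrite big_seq big1 // => i /h; rewrite negbK => /eqP.
have t2 : t m2 != 0 by apply: contraNneq n2 => ->; rewrite mulr0.
have [m1 _ n1] : exists2 m1, m1 \in msupp q@_m2 & q@_m2@_m1 * s m1 != 0.
  apply/hasP; apply: contraNT n2 => /hasPn h; rewrite evE.
  by rewrite big_seq big1 ?mul0r // => i /h; rewrite negbK => /eqP.
have s1 : s m1 != 0 by apply: contraNneq n1 => ->; rewrite mulr0.
have c1 : q@_m2@_m1 != 0 by apply: contraNneq n1 => ->; rewrite mul0r.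
exists m1, m2; split=> //.
case: (hm m2) => [E|[le2 h2]]; first by rewrite E mcoeff0 eqxx in c1.
case: (h2 m1) => [E|[le1 [E|h1]]]; try by rewrite E eqxx in c1.
by lia.
Qed.

Let e2 j := (2 ^ (ones j.+2).-1)%N.
Let tau1 : {rmorphism P1 -> P1} := subst malgC (fun j => gen j *+ e2 j).
Let tau2 : {rmorphism P2 -> P2} := subst (malgC \o tau1) (fun j => gen j *+ e2 j).

Lemma mev_e2 (R : comNzRingType) (m : mon) :
  mev (fun j => gen j *+ e2 j) m = << m >> *+ 2 ^ ht m :> {malg R[mon]}.
Proof.
elim/mon_ind: m => [|i m IH]; first by rewrite mev1 /ht wgt1.
rewrite mevM IH mevU mulrnAl mulrnAr -mulrnA mulnC /ht wgtM wgtU expnD.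
by congr (_ *+ _); exact: mulUU.
Qed.

Lemma ev_tau s s' p : (forall m, s m = s' m *+ 2 ^ ht m) -> ev s p = ev s' (tau1 p).
Proof.
move=> h; rewrite (monalgE p) !raddf_sum; apply: eq_bigr => m _ /=.
rewrite [LHS]evU /tau1 /= substU mev_e2 mulrnAr raddfMn /= CmulU1 [in RHS]evU.
by rewrite h mulrnAr.
Qed.

Lemma ev2_tau s s' t t' q : (forall m, s m = s' m *+ 2 ^ ht m) ->
  (forall m, t m = t' m *+ 2 ^ ht m) -> ev2 s t q = ev2 s' t' (tau2 q).
Proof.
move=> h1 h2; rewrite (monalgE q) !raddf_sum; apply: eq_bigr => m _ /=.
rewrite [LHS]ev2U /tau2 /= substU mev_e2 mulrnAr raddfMn /= CmulU1 [in RHS]ev2U.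
by rewrite h2 mulrnAr (ev_tau _ h1).
Qed.

Lemma tau_cop m : dvd2 (ht m) (tau2 (mev (cop_gen K) m)).
Proof.
elim/mon_ind: m => [|i m IH]; first by rewrite /ht wgt1; exact: dvd20.
rewrite mevM rmorphM /ht wgtM wgtU mevU; apply: dvd2M => //.
rewrite /cop_gen rmorph_scomp /scomp.
have fs (v : nat -> P2) : (forall j, dvd2 (ones j.+2).-1 (v j)) ->
    forall n, filt 1 (series v n).
  move=> hv n e; rewrite coef_poly; case: ifP => _; last exact: dvd2_0.
  case: e => [|[|e]] /=; first exact: dvd2_0.
    by rewrite ones1; exact: dvd20.
  by rewrite subn1.
rewrite -subn1; apply: filt_comp; first exact: series0.
  apply: fs => j /=; exists (gen j); exact: subst_gen.
apply: fs => j /=; exists (gen j)%:MP.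
by rewrite /tau2 /= substC /= /tau1 /= subst_gen raddfMn.
Qed.

Lemma conv_dvd2 s t m : (forall m, dvd2 (ht m) (s m)) ->
  (forall m, dvd2 (ht m) (t m)) -> dvd2 (ht m) (conv s t m).
Proof.
move=> /choice[s' hs] /choice[t' ht']; rewrite conv.unlock.
rewrite (ev2_tau _ hs ht'); have [q ->] := tau_cop m.
by rewrite raddfMn; eexists.
Qed.
End Functionals.

Section Naturality.
Context {K L : comNzRingType} (f : {rmorphism K -> L}).
Local Notation P1 K := {malg K[mon]}.
Local Notation P2 K := {malg {malg K[mon]}[mon]}.
Let map1 : {rmorphism P1 K -> P1 L} := subst (malgC \o f) gen.
Let map2 : {rmorphism P2 K -> P2 L} := subst (malgC \o map1) gen.

Lemma rmorph_ev s p : f (ev s p) = ev (f \o s) (map1 p).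
Proof.
rewrite (monalgE p) !raddf_sum; apply: eq_bigr => m _ /=.
rewrite /map1 /= substU mev_gen /= CmulU1 [in LHS]evU [RHS]evU.
by rewrite rmorphM.
Qed.

Lemma rmorph_ev2 s t q : f (ev2 s t q) = ev2 (f \o s) (f \o t) (map2 q).
Proof.
rewrite (monalgE q) !raddf_sum; apply: eq_bigr => m _ /=.
rewrite /map2 /= substU mev_gen /= CmulU1 [in LHS]ev2U [RHS]ev2U.
by rewrite rmorphM rmorph_ev.
Qed.

Lemma rmorph_conv s t m : f (conv s t m) = conv (f \o s) (f \o t) m.
Proof.
rewrite conv.unlock rmorph_ev2; congr ev2; rewrite rmorph_mev.
apply: eq_mev => j /=; rewrite /cop_gen rmorph_scomp.
apply: eq_scomp => i /=; last exact: subst_gen.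
by rewrite /map2 /= substC /= /map1 /= subst_gen.
Qed.
End Naturality.

Section Operations.
Context (K : comNzRingType).

Definition bounded (s : mon -> K) : Prop :=
  exists N, forall m, (N <= deg m)%N -> s m = 0.

(* Functionals of bounded degree on the K-algebra generated by the coefficients
   of the power series sum_e 2^(ones e - 1) xi_e x^e with xi_1 = 1.  Such a
   functional s is recorded by its values on the monomials in the generators
   2^(ones e - 1) xi_e, so s m is a multiple of 2^(ht m).
   - K = Z/4: the series are sum_k xi_k x^(2^k) + sum_(k<l) 2 xi_{k,l} x^(2^k+2^l)
     and opalg K is Nassau's D_0.
   - K = F_2: the series are sum_k xi_k x^(2^k), the functionals vanish on every
     monomial involving another coefficient, and opalg K is the Steenrod
     algebra as the dual of Milnor's Hopf algebra F_2[xi_1, xi_2, ...]. *)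
Definition op_pred : {pred mon -> K} :=
  fun s => `[< bounded s /\ forall m, dvd2 (ht m) (s m) >].

Record opalg := Op { op_fun :> mon -> K; opP : op_fun \in op_pred }.
HB.instance Definition _ := [isSub for op_fun].
HB.instance Definition _ := [Choice of opalg by <:].

Lemma op_predP s :
  reflect (bounded s /\ forall m, dvd2 (ht m) (s m)) (s \in op_pred).
Proof. exact: asboolP. Qed.

Lemma op_zmod_closed : zmod_closed op_pred.
Proof.
split=> [|s t /op_predP[[N hN] hs] /op_predP[[M hM] ht']]; apply/op_predP.
  by split; [exists 0%N | move=> m; exact: dvd2_0].
split=> [|m]; last by apply: dvd2D; last exact: dvd2N.
exists (N + M)%N => m h; change (s m - t m = 0).
by rewrite hN ?hM ?subr0 // (leq_trans _ h) // (leq_addl, leq_addr).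
Qed.
HB.instance Definition _ := GRing.isZmodClosed.Build (mon -> K) op_pred op_zmod_closed.
HB.instance Definition _ := [SubChoice_isSubZmodule of opalg by <:].

Lemma opalgP (s t : opalg) : (forall m, s m = t m) -> s = t.
Proof. by move=> h; apply/val_inj/funext. Qed.

Lemma op_bounded (s : opalg) : bounded s. Proof. by case/op_predP: (opP s). Qed.
Lemma op_dvd2 (s : opalg) m : dvd2 (ht m) (s m).
Proof. by case/op_predP: (opP s). Qed.

Lemma op_mul_subproof (s t : opalg) : conv s t \in op_pred.
Proof.
apply/op_predP; split=> [|m]; last by apply: conv_dvd2 => ?; exact: op_dvd2.
have [N hN] := op_bounded s; have [M hM] := op_bounded t.
exists (N + M)%N => m h; apply/eqP; apply: contraTT h => /conv_support.
case=> m1 [m2 [<- s1 t2]]; rewrite -ltnNge.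
have : (deg m1 < N)%N by rewrite ltnNge; apply: contraNN s1 => /hN ->.
have : (deg m2 < M)%N by rewrite ltnNge; apply: contraNN t2 => /hM ->.
lia.
Qed.
Definition op_mul s t : opalg := Op (op_mul_subproof s t).

Lemma op_dual_subproof (m0 : mon) :
  (fun m => (m == m0)%:R *+ 2 ^ ht m0) \in op_pred.
Proof.
apply/op_predP; split=> [|m]; last first.
  by case: eqP => [->|_]; [eexists | rewrite mul0rn; exact: dvd2_0].
exists (deg m0).+1 => m; case: eqP => [->|_]; rewrite ?ltnn // mul0rn //.
Qed.
(* Dual of the generator monomial m0 in the monomial basis. *)
Definition op_dual m0 : opalg := Op (op_dual_subproof m0).

Lemma op_dual1 m : op_dual mone m = fone m.
Proof. by rewrite /= /ht wgt1. Qed.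

Lemma op_mulA : associative op_mul.
Proof. by move=> s t u; apply: opalgP => m; exact: convA. Qed.
Lemma op_mul1s : left_id (op_dual mone) op_mul.
Proof.
move=> s; apply: opalgP => m /=.
by rewrite (_ : (fun _ => _) = fone :> (mon -> K)) ?conv1f //; apply/funext/op_dual1.
Qed.
Lemma op_muls1 : right_id (op_dual mone) op_mul.
Proof.
move=> s; apply: opalgP => m /=.
by rewrite (_ : (fun _ => _) = fone :> (mon -> K)) ?convf1 //; apply/funext/op_dual1.
Qed.
Lemma op_mulDl : left_distributive op_mul +%R.
Proof. by move=> s t u; apply: opalgP => m; exact: convDl. Qed.
Lemma op_mulDr : right_distributive op_mul +%R.
Proof. by move=> s t u; apply: opalgP => m; exact: convDr. Qed.
Lemma op_1neq0 : op_dual mone != 0.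
Proof.
apply/eqP => /(congr1 (fun s : opalg => s mone)); rewrite op_dual1 /fone eqxx.
by move/eqP; rewrite oner_eq0.
Qed.
HB.instance Definition _ := GRing.Zmodule_isNzRing.Build opalg
  op_mulA op_mul1s op_muls1 op_mulDl op_mulDr op_1neq0.

Lemma op_cap_subproof (m0 : mon) (s : opalg) : (fun m => s (m0 ** m)) \in op_pred.
Proof.
apply/op_predP; split=> [|m].
  have [N hN] := op_bounded s; exists N => m h; apply: hN.
  by rewrite /deg wgtM (leq_trans h) // leq_addl.
by apply: dvd2_le (op_dvd2 s (m0 ** m)); rewrite /ht wgtM leq_addl.
Qed.
(* Cap product: <op_cap m0 s, m> = <s, m0 m>. *)
Definition op_cap m0 s : opalg := Op (op_cap_subproof m0 s).

(* Some N such that s vanishes in all degrees >= N. *)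
Definition op_size (s : opalg) : nat := sval (cid (op_bounded s)).

Definition homog (d : nat) (s : opalg) : Prop := forall m, s m != 0 -> deg m = d.
End Operations.

Notation D0 := (opalg 'Z_4).
Notation steenrod := (opalg 'F_2).

Definition red (x : 'Z_4) : 'F_2 := (x : nat)%:R.

Lemma red_additive : additive red.
Proof. by move=> [[|[|[|[|?]]]] //= ?] [[|[|[|[|?]]]] //= ?]; apply/val_inj. Qed.
Lemma red_multiplicative : multiplicative red.
Proof.
split; last exact/val_inj.
by move=> [[|[|[|[|?]]]] //= ?] [[|[|[|[|?]]]] //= ?]; apply/val_inj.
Qed.
HB.instance Definition _ := GRing.isAdditive.Build 'Z_4 'F_2 red red_additive.
HB.instance Definition _ :=
  GRing.isMultiplicative.Build 'Z_4 'F_2 red red_multiplicative.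

Lemma pi_subproof (s : D0) : red \o s \in @op_pred 'F_2.
Proof.
apply/op_predP; split=> [|m] /=.
  by have [N hN] := op_bounded s; exists N => m /hN /= ->; rewrite raddf0.
by have [c ->] := op_dvd2 s m; exists (red c); rewrite raddfMn.
Qed.
(* Reduction D_0 -> A modulo 2. *)
Definition pi (s : D0) : steenrod := Op (pi_subproof s).

Lemma pi_additive : additive pi.
Proof. by move=> s t; apply: opalgP => m; exact: (raddfB red). Qed.
Lemma pi_multiplicative : multiplicative pi.
Proof.
split=> [s t|]; apply: opalgP => m; first exact: (rmorph_conv red).
rewrite /= raddfMn /=; congr (_ *+ _).
by case: (m == mone); rewrite ?rmorph0 ?rmorph1.
Qed.
HB.instance Definition _ := GRing.isAdditive.Build D0 steenrod pi pi_additive.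
HB.instance Definition _ := GRing.isMultiplicative.Build D0 steenrod pi pi_multiplicative.

(* The kernel of D_0 -> A; it is spanned by the 2 a and Y_{k,l} a. *)
Definition RD_pred : {pred D0} := fun r => pi r == 0.
Record RD := InRD { RD_val :> D0; RD_valP : RD_val \in RD_pred }.
HB.instance Definition _ := [isSub for RD_val].
HB.instance Definition _ := [Choice of RD by <:].
Lemma RD_zmod_closed : zmod_closed RD_pred.
Proof.
split=> [|r s]; rewrite !unfold_in ?raddf0 // raddfB /=.
by move=> /eqP -> /eqP ->; rewrite subr0.
Qed.
HB.instance Definition _ := GRing.isZmodClosed.Build D0 RD_pred RD_zmod_closed.
HB.instance Definition _ := [SubChoice_isSubZmodule of RD by <:].

Lemma RD_mull_subproof (d : D0) (r : RD) : d * r \in RD_pred.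
Proof. by rewrite unfold_in rmorphM /= (eqP (RD_valP r)) mulr0. Qed.
Lemma RD_mulr_subproof (r : RD) (d : D0) : (r : D0) * d \in RD_pred.
Proof. by rewrite unfold_in rmorphM /= (eqP (RD_valP r)) mul0r. Qed.
Lemma RD_two_subproof (d : D0) : d *+ 2 \in RD_pred.
Proof.
rewrite unfold_in raddfMn /= mulr2n; apply/eqP/opalgP => m.
by change (pi d m + pi d m = 0); case: (pi d m) => [[|[|?]]] //= ?; apply/val_inj.
Qed.

Lemma two_F2 (x : 'F_2) : x *+ 2 = 0.
Proof. by case: x => [[|[|?]]] //= ?; apply/val_inj. Qed.

(* xi k is the coefficient of x^(2^k), with xi 0 = 1; for k < l, eta k l is the
   coefficient 2 xi_{k,l} of x^(2^k + 2^l). *)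
Definition xi (k : nat) : mon := if k is 0 then mone else ucm (2 ^ k - 2)%N.
Definition eta (k l : nat) : mon := ucm (2 ^ k + 2 ^ l - 2)%N.

(* The square for K = F_2 and its lift for K = Z/4, both dual to xi_1^a. *)
Definition Sq (K : comNzRingType) (a : nat) : opalg K :=
  op_dual K (expcmn (xi 1) a).
Definition Y (k l : nat) : D0 := op_dual 'Z_4 (eta k l).

Lemma ones_pow2M k n : ones (2 ^ k * n) = ones n.
Proof.
by elim: k => [|k IH]; rewrite ?mul1n // expnS -mulnA mul2n ones_double.
Qed.

Lemma ones_pow2D k l : (k < l)%N -> ones (2 ^ k + 2 ^ l) = 2.
Proof.
move=> kl; have -> : (2 ^ k + 2 ^ l = 2 ^ k * (true + (2 ^ (l - k.+1)).*2))%N.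
  by rewrite mulnDr muln1 -mul2n -expnS -expnD; congr (_ + 2 ^ _)%N; lia.
by rewrite ones_pow2M ones_bit -[X in ones X]muln1 ones_pow2M ones1.
Qed.

Lemma ht_eta k l : (k < l)%N -> ht (eta k l) = 1%N.
Proof.
move=> kl; rewrite /ht wgtU -subn1.
have -> : (2 ^ k + 2 ^ l - 2).+2 = (2 ^ k + 2 ^ l)%N.
  by have := expn_gt0 2 k; have := expn_gt0 2 l; lia.
by rewrite ones_pow2D.
Qed.

Lemma pi_Y k l : (k < l)%N -> pi (Y k l) = 0.
Proof.
move=> kl; apply: opalgP => m; rewrite [LHS]/= ht_eta // expn1.
by rewrite raddfMn /= two_F2.
Qed.

Definition halve (x : 'Z_4) : 'F_2 := (x./2)%:R.

Lemma op_halve_subproof (s : D0) :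
  (fun m => if ht m == 0%N then halve (s m) else 0) \in @op_pred 'F_2.
Proof.
apply/op_predP; split=> [|m].
  have [N hN] := op_bounded s; exists N => m /hN ->.
  by case: ifP => // _; apply/val_inj.
by case: eqP => [->|_]; [exact: dvd20 | exact: dvd2_0].
Qed.
(* If r in the kernel of pi is written as 2 b + sum_(k<l) Y_{k,l} c_{k,l}, with
   b and c_{k,l} determined modulo 2, then b is op_halve r and c_{k,l} is
   op_halve (op_cap (eta k l) r). *)
Definition op_halve (s : D0) : steenrod := Op (op_halve_subproof s).

(* D_1 is the sum, as a right A-module, of a copy of A (in degrees shifted by
   one) and of the summands mu_0 A and U_{k,l} A, 0 <= k < l.  The boundary maps
   the latter isomorphically onto the kernel of D_0 -> A, which represents them
   here.  As a bimodule D_1 is not a direct sum: the left action is twisted. *)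
Definition D1 := (steenrod * RD)%type.
HB.instance Definition _ := GRing.Zmodule.on D1.

Definition bd (x : D1) : D0 := x.2.

Definition inA (a : steenrod) : D1 := (a, 0).
Definition mu0 (d : D0) : D1 := (0, InRD (RD_two_subproof d)).
Definition U (k l : nat) (d : D0) : D1 := (0, insubd 0 (Y k l * d)).

Lemma bd_inA a : bd (inA a) = 0. Proof. by []. Qed.
Lemma bd_mu0 d : bd (mu0 d) = d *+ 2. Proof. by []. Qed.
Lemma bd_U k l d : (k < l)%N -> bd (U k l d) = Y k l * d.
Proof.
move=> kl; have h : Y k l * d \in RD_pred.
  by rewrite unfold_in rmorphM /= pi_Y // mul0r.
by rewrite /bd /= insubdK.
Qed.

(* The A-component of a . (0, r): for r = 2 b + sum_(k<l) Y_{k,l} c_{k,l} it is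
     (xi_1 cap a) b
     + sum_(k<l) sum_(k+i >= l+j)
         Sq(P_(k+i) + P_(l+j)) ((xi_i^(2^k) xi_j^(2^l)) cap a) c_{k,l},
   with Sq(P_p + P_q) dual to xi_p xi_q; equivalently, in D_1,
     a mu_0 = mu_0 a + (xi_1 cap a),
     a U_{k,l} = sum_(i,j) U_{k+i,l+j} ((xi_i^(2^k) xi_j^(2^l)) cap a),
   where U_{m,n} = U_{n,m} + Sq(P_m + P_n) for m > n and
   U_{m,m} = mu_0 Sq(P_(m+1)) + Sq(2 P_m).
   Terms with an index >= N vanish, so the bound N is immaterial. *)
Definition twist (a : steenrod) (r : RD) : steenrod :=
  let N := (op_size a + op_size (r : D0))%N in
  op_cap (xi 1) a * op_halve r +
  \sum_(k < N) \sum_(l < N | (k < l)%N) \sum_(i < N) \sum_(j < N | (l + j <= k + i)%N)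
    op_dual 'F_2 (xi (k + i) ** xi (l + j)) *
    (op_cap (expcmn (xi i) (2 ^ k) ** expcmn (xi j) (2 ^ l)) a *
     op_halve (op_cap (eta k l) (r : D0))).

Definition lact (d : D0) (x : D1) : D1 :=
  (pi d * x.1 + twist (pi d) x.2, InRD (RD_mull_subproof d x.2)).
Definition ract (x : D1) (d : D0) : D1 :=
  (x.1 * pi d, InRD (RD_mulr_subproof x.2 d)).

Definition homog1 (d : nat) (x : D1) : Prop :=
  (forall m, x.1 m != 0 -> (deg m).+1 = d) /\ homog d (bd x).

(* A word lists the exponents of a product of squares.  Letters 0 (Sq^0 = 1)
   are never kept.  wsum is the space of formal sums of words mod 2. *)
Definition word := seq nat.
Definition wsum := {malg 'F_2[word]}.
HB.instance Definition _ := GRing.Zmodule.on wsum.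

Definition admissible (w : word) : bool := sorted (fun a b => b.*2 <= a)%N w.

Definition sqword (K : comNzRingType) (w : word) : opalg K := \prod_(a <- w) Sq K a.
(* For K = F_2 the element of A represented by a formal sum of words, for
   K = Z/4 its word lift to D_0. *)
Definition realize (K : comNzRingType) (x : wsum) : opalg K :=
  \sum_(w <- msupp x) sqword K w.

Definition adem_idx (a b : nat) : seq nat :=
  [seq k <- iota 0 (a./2).+1 | odd 'C(b - k - 1, a - k.*2)].
Definition bracket (K : comNzRingType) (a b : nat) : opalg K :=
  Sq K a * Sq K b + \sum_(k <- adem_idx a b) Sq K (a + b - k) * Sq K k.

Definition tail2 (k : nat) (w : word) : word := if k == 0%N then w else k :: w.

(* Leftmost inadmissible adjacent pair, as (alpha, a, b, beta). *)
Fixpoint bad_pair (w : word) : option (word * nat * nat * word) :=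
  if w is a :: w' then
    if w' is b :: w'' then
      if (a < b.*2)%N then Some ([::], a, b, w'')
      else if bad_pair w' is Some (al, a', b', be) then Some (a :: al, a', b', be)
      else None
    else None
  else None.

Definition rewrites (w : word) : seq word :=
  if bad_pair w is Some (al, a, b, be) then
    [seq al ++ (a + b - k)%N :: tail2 k be | k <- adem_idx a b]
  else [::].

(* Sum of the i-th letters multiplied by i; every rewriting step decreases it,
   so it is enough fuel for the recursive definitions below, which satisfy the
   equations admE, track_admissible, trackE and traceE. *)
Fixpoint moment (w : word) : nat :=
  if w is a :: w' then (a + sumn w' + moment w')%N else 0%N.

Lemma bad_pair_cons x y w : bad_pair [:: x, y & w] =
  if (x < y.*2)%N then Some ([::], x, y, w)
  else if bad_pair (y :: w) is Some (al, a, b, be) then Some (x :: al, a, b, be)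
  else None.
Proof. by []. Qed.

Lemma bad_pairP w al a b be : bad_pair w = Some (al, a, b, be) ->
  w = al ++ a :: b :: be /\ (a < b.*2)%N.
Proof.
elim: w al => [|x [|y w] IH] al //; rewrite bad_pair_cons.
case: ifP => [h|_]; first by case=> <- <- <- <-.

case E: (bad_pair (y :: w)) => [[[[al' a'] b'] be']|] // [<- Ea Eb Ec].
by move: E; rewrite Ea Eb Ec => /IH [-> ?].
Qed.

Lemma bad_pairN w : (bad_pair w == None) = admissible w.
Proof.
elim: w => [|x [|y w] IH] //; rewrite bad_pair_cons.
rewrite -[admissible _]/((y.*2 <= x)%N && admissible (y :: w)) -IH.
by case: (ltnP x y.*2) => _; case: (bad_pair (y :: w)) => [[[[? ?] ?] ?]|].
Qed.

Lemma rewrites_moment w v : v \in rewrites w -> (moment v < moment w)%N.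
Proof.
rewrite /rewrites; case E: (bad_pair w) => [[[[al a] b] be]|] //.
have [-> ab] := bad_pairP E => /mapP[k]; rewrite mem_filter mem_iota add0n ltnS.
move=> /andP[_ /andP[_ ka]] ->.
have kb : (k < b)%N by lia.
suff [h1 h2] : sumn ((a + b - k)%N :: tail2 k be) = sumn (a :: b :: be) /\
    (moment ((a + b - k)%N :: tail2 k be) < moment (a :: b :: be))%N.
  elim: al {E} => [|c al IH] //=; rewrite !sumn_cat h1; lia.
rewrite /tail2; case: eqP => [k0|_] /=; split; lia.
Qed.

Fixpoint adm_rec (n : nat) (w : word) : wsum :=
  if (n, bad_pair w) is (n'.+1, Some _) then \sum_(v <- rewrites w) adm_rec n' v
  else << w >>.
Definition adm (w : word) : wsum := adm_rec (moment w) w.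

Fixpoint track_rec (u : nat -> nat -> D1) (n : nat) (w : word) : D1 :=
  if (n, bad_pair w) is (n'.+1, Some (al, a, b, be)) then
    lact (sqword 'Z_4 al) (ract (u a b) (sqword 'Z_4 be))
    + \sum_(v <- rewrites w) track_rec u n' v
  else 0.
Definition track u (w : word) : D1 := track_rec u (moment w) w.

(* The words, with repetitions, of the written-out boundary of track u w: for
   each summand alpha u[a,b] beta, the words of alpha [a,b] beta. *)
Fixpoint trace_rec (n : nat) (w : word) : seq word :=
  if (n, bad_pair w) is (n'.+1, Some _) then
    w :: rewrites w ++ flatten [seq trace_rec n' v | v <- rewrites w]
  else [::].
Definition trace (w : word) : seq word := trace_rec (moment w) w.

Section Unfold.
Context {T : Type} (f : (word -> T) -> word -> T) (rec : nat -> word -> T).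
Hypothesis rec0 : forall n w, bad_pair w = None -> rec n w = rec 0%N w.
Hypothesis recS : forall n w, bad_pair w <> None -> rec n.+1 w = f (rec n) w.
Hypothesis f_ext : forall g h w,
  (forall v, v \in rewrites w -> g v = h v) -> f g w = f h w.

Lemma moment_gt0 w : bad_pair w <> None -> (0 < moment w)%N.
Proof.
case E: (bad_pair w) => [[[[al a] b] be]|] // _.
have [-> ab] := bad_pairP E; elim: al {E} => [|c al IH] /=; lia.
Qed.

Lemma rec_stable n w : (moment w <= n)%N -> rec n w = rec (moment w) w.
Proof.
elim/ltn_ind: n w => n IH w h; case E: (bad_pair w) => [p|]; last first.
  by rewrite rec0 // [RHS]rec0.
have nb : bad_pair w <> None by rewrite E.
have m0 := moment_gt0 nb; case: n h IH => [|n] h IH; first by lia.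
case Em: (moment w) m0 => [|m] // _; rewrite !recS //; apply: f_ext => v hv.
have := rewrites_moment hv; rewrite Em ltnS => hm.
rewrite IH //; last by lia.
by rewrite [RHS]IH //; lia.
Qed.

Lemma rec_unfold w : bad_pair w <> None ->
  rec (moment w) w = f (fun v => rec (moment v) v) w.
Proof.
move=> nb; have := moment_gt0 nb; case Em: (moment w) => [|m] // _.
rewrite recS //; apply: f_ext => v hv; apply: rec_stable.
by have := rewrites_moment hv; rewrite Em ltnS.
Qed.
End Unfold.

Lemma admE w :
  adm w = if admissible w then << w >> else \sum_(v <- rewrites w) adm v.
Proof.
rewrite -bad_pairN; case: eqP => [E|nb].
  by rewrite /adm; case: (moment w) => [|n] //=; rewrite E.
apply: (@rec_unfold _ (fun g w => \sum_(v <- rewrites w) g v) adm_rec) => //.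
- by move=> [|n] v //= ->.
- by move=> n v /=; case: (bad_pair v).
by move=> g h v e; apply: eq_big_seq.
Qed.

Lemma track_admissible u w : admissible w -> track u w = 0.
Proof.
by rewrite -bad_pairN /track => /eqP E; case: (moment w) => [|n] //=; rewrite E.
Qed.

Lemma trackE u w al a b be : bad_pair w = Some (al, a, b, be) ->
  track u w = lact (sqword 'Z_4 al) (ract (u a b) (sqword 'Z_4 be))
              + \sum_(v <- rewrites w) track u v.
Proof.
move=> E; pose f g w : D1 :=
  if bad_pair w is Some (al, a, b, be) then
    lact (sqword 'Z_4 al) (ract (u a b) (sqword 'Z_4 be)) + \sum_(v <- rewrites w) g v
  else 0.
have r0 n v : bad_pair v = None -> track_rec u n v = track_rec u 0 v.
  by case: n => [|n] //= ->.
have rS n v : bad_pair v <> None -> track_rec u n.+1 v = f (track_rec u n) v.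
  by rewrite /f /=; case: (bad_pair v) => [[[[? ?] ?] ?]|].
have fe g h v : (forall v', v' \in rewrites v -> g v' = h v') -> f g v = f h v.
  move=> e; rewrite /f; case: (bad_pair v) => [[[[? ?] ?] ?]|] //.
  by congr (_ + _); apply: eq_big_seq.
by rewrite [LHS](rec_unfold r0 rS fe) ?E // /f E.
Qed.

Lemma traceE w :
  trace w = if admissible w then [::]
            else w :: rewrites w ++ flatten [seq trace v | v <- rewrites w].
Proof.
rewrite -bad_pairN; case: eqP => [E|nb].
  by rewrite /trace; case: (moment w) => [|n] //=; rewrite E.
apply: (@rec_unfold _ (fun g w => w :: rewrites w ++ flatten [seq g v | v <- rewrites w])
  trace_rec) => //.
- by move=> [|n] v //= ->.
- by move=> n v /=; case: (bad_pair v).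
by move=> g h v e; congr (_ :: _ ++ flatten _); apply/eq_in_map.
Qed.

Definition Adm (x : wsum) : wsum := \sum_(w <- msupp x) adm w.
Definition track_sum u (x : wsum) : D1 := \sum_(w <- msupp x) track u w.

(* The words v such that a pair v + v is cancelled when the written-out boundary
   of track_sum u x is reduced modulo 2, once for every such pair. *)
Definition cancelled (x : wsum) : seq word :=
  let B := flatten [seq trace w | w <- enum_fset (msupp x)] in
  flatten [seq nseq (count_mem v B)./2 v | v <- undup B].

Definition corrected_track u (x : wsum) : D1 :=
  track_sum u x + \sum_(v <- cancelled x) mu0 (sqword 'Z_4 v).

Section RowMap.
Context (K : comNzRingType).

(* The free module with one generator e_c of degree c for each c, and the row
   map e_c |-> Sq^c.  The columns of a row have distinct degrees, so they are
   indexed by their degrees. *)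
Definition freemod := {malg (opalg K)[nat]}.
HB.instance Definition _ := GRing.Zmodule.on freemod.

Definition row_map (x : freemod) : opalg K :=
  \sum_(c <- msupp x) x@_c * Sq K c.

Definition homog_mod (d : nat) (x : freemod) : Prop :=
  forall c m, x@_c m != 0 -> (deg m + c = d)%N.

Definition realize_mod (a : {malg wsum[nat]}) : freemod :=
  \sum_(c <- msupp a) << realize K a@_c *g c >>.
End RowMap.

(* The rows (Sq^n), (Sq^1, Sq^n) and (Sq^1, Sq^2, Sq^4, Sq^6, ...). *)
Inductive first_row := row_F_n of nat | row_F_nZ of nat | row_F.

Definition valid_row (r : first_row) : bool :=
  match r with row_F_n n => (0 < n)%N | row_F_nZ n => (1 < n)%N | row_F => true end.

Definition columns (r : first_row) : pred nat :=
  match r with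
  | row_F_n n => pred1 n
  | row_F_nZ n => pred2 1%N n
  | row_F => [pred c | (c == 1%N) || (0 < c)%N && ~~ odd c]
  end.

(* The formal sum of words sum_c a_c Sq^c. *)
Definition row_words (a : {malg wsum[nat]}) : wsum :=
  \sum_(c <- msupp a) \sum_(w <- msupp a@_c) << rcons w c >>.

Definition row_syzygy (cols : pred nat) (d : nat) (rho : freemod 'F_2) : Prop :=
  [/\ {subset msupp rho <= cols}, homog_mod d rho & row_map rho = 0].

(* a expresses each coefficient of rho as a formal sum of words of the right
   degree. *)
Definition word_form (cols : pred nat) (d : nat) (rho : freemod 'F_2)
    (a : {malg wsum[nat]}) : Prop :=
  [/\ {subset msupp a <= cols},
      forall c w, w \in msupp a@_c -> (0%N \notin w) && (sumn w + c == d)%N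
    & realize_mod 'F_2 a = rho].

(* A map from the free module Sigma^d D to the source of d_1 is given by the
   image x of the generator; a track d_1 x => 0 is then an element H of degree d
   of D_1 with boundary d_1 x. *)
Definition first_secondary_cycle (cols : pred nat) (d : nat)
    (x : freemod 'Z_4) (H : D1) : Prop :=
  [/\ {subset msupp x <= cols}, homog_mod d x, homog1 d H & bd H = row_map x].

(* [a,b] lifts to D_0 with coefficients 0 and 1. *)
Definition secondary_adem_track (u : nat -> nat -> D1) : Prop :=
  forall a b, (0 < a < b.*2)%N ->
    bd (u a b) = bracket 'Z_4 a b /\ homog1 (a + b) (u a b).

Definition is_admissible_form (z : opalg 'F_2) (x : wsum) : Prop :=
  (forall w, w \in msupp x -> admissible w /\ 0%N \notin w) /\ realize 'F_2 x = z.

(* Word lift of the admissible normal form of z. *)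
Definition admissible_lift (z : opalg 'F_2) : D0 :=
  if pselect (exists x, is_admissible_form z x) is left h
  then realize 'Z_4 (sval (cid h)) else 0.

(* Main.v *)
Require Import Defs.
From mathcomp Require Import all_boot all_order all_algebra finmap.
From mathcomp Require Import monalg boolp zify.
Set Implicit Arguments. Unset Strict Implicit. Unset Printing Implicit Defensive.
Import GRing.Theory.
Local Open Scope ring_scope.

(** Modulo 2 the words written out in the boundary of [track u w] sum to
    [w + adm w].  In [Z/4] a word of multiplicity [2q + e] contributes
    [(2q + e) + 2q = e] times its lift once [mu0] has been added for its [q]
    cancelled pairs, so the boundary of the corrected track of [x] is the word
    lift of [x + Adm x], the sum being taken modulo 2.  The Adem relations in [A]
    come for free from the boundaries of the tracks [u a b], so [Adm x] and [x]
    have the same value in [A].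

    It remains to see that admissible words are independent in the dual of
    Milnor's Hopf algebra.  Left multiplication by [sum_a Sq^a T^a] is dual to the
    substitution [xi_(i+1) |-> xi_(i+1) + T^(2^i) xi_i], whose term of top degree
    in [T] is [xi_i]; hence each admissible word pairs to 1 with a monomial on
    which all lexicographically larger words vanish.

    In (a) this gives [Adm x = 0].  In (b), [Adm x] lies in [A Sq^1], so it is
    killed by right multiplication by [Sq^1], which forces its words to end in
    [Sq^1]; as the words of [x] do not, nothing cancels in [x + Adm x]. *)

Local Arguments xi : simpl never.
Local Arguments Sq : simpl never.
(* generic_quotient's pi shadows the reduction D_0 -> A. *)
Local Notation pi := Defs.pi.
Local Notation P1 := {malg 'F_2[mon]}.
Local Notation P2 := {malg P1[mon]}.

(** * Milnor's dual and the independence of admissible words *)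

Lemma ones_eq1 j : ones j = 1%N -> exists k, j = (2 ^ k)%N.
Proof.
elim/ltn_ind: j => j IH; rewrite ones_half.
have [->|j0] := posnP j; first by rewrite ones0.
case oj: (odd j) => /= h; last first.
  by have [k Ek] := IH j./2 ltac:(lia) h; exists k.+1; rewrite expnS -Ek; lia.
exists 0%N; have [|h2] := posnP j./2; first by lia.
by have := ones_gt0 h2; lia.
Qed.

Lemma ones_pow2 k : ones (2 ^ k) = 1%N.
Proof. by rewrite -[(2 ^ k)%N]muln1 ones_pow2M ones1. Qed.

Lemma pow2_eq k l : (2 ^ k == 2 ^ l)%N = (k == l).
Proof. by apply/eqP/eqP => [|-> //]; apply: expnI. Qed.

(* A steenrod functional vanishes on the monomials involving a coefficient of x^e
   with e not a power of 2, and Sq^a sees only powers of xi_1; so in the coproduct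
   all other coefficients may be set to 0, and xi_1 of the left factor to T. *)
Definition lgen (j : nat) : {poly P1} := if j == 0%N then 'X else 0.
Definition rgen (j : nat) : P1 := if (ones j.+2).-1 == 0%N then gen j else 0.

Definition lsubst : {rmorphism P1 -> {poly P1}} :=
  subst (polyC \o malgC : {rmorphism 'F_2 -> {poly P1}}) lgen.
Definition sq_subst : {rmorphism P2 -> {poly P1}} :=
  subst lsubst (fun j => (rgen j)%:P).

Lemma expcmnS (m : mon) n : expcmn m n.+1 = mmul m (expcmn m n).
Proof. by case: n => [|n] //; rewrite mulm1. Qed.

Lemma wgt_expcmn c m n : wgt c (expcmn m n) = (n * wgt c m)%N.
Proof. by elim: n => [|n IH]; rewrite ?wgt1 // expcmnS wgtM IH mulSn. Qed.

Lemma ht_xi k : ht (xi k) = 0%N.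
Proof.
case: k => [|k]; first by rewrite /ht wgt1.
rewrite /ht wgtU (_ : (2 ^ k.+1 - 2).+2 = (2 ^ k.+1)%N) ?ones_pow2 //.
by have := expn_gt0 2 k; rewrite expnS; lia.
Qed.

Lemma ht_expcmn m n : ht (expcmn m n) = (n * ht m)%N.
Proof. exact: wgt_expcmn. Qed.

Lemma SqE (K : comNzRingType) a m : Sq K a m = (m == expcmn (xi 1) a)%:R.
Proof.
rewrite -[LHS]/((m == expcmn (xi 1) a)%:R *+ 2 ^ ht (expcmn (xi 1) a)).
by rewrite ht_expcmn ht_xi muln0 expn0 mulr1n.
Qed.

Lemma expcm_xi1E a j : expcmn (xi 1) a j = ((j == 0) * a)%N.
Proof.
elim: a => [|a IH]; first by rewrite cm1 muln0.
by rewrite expcmnS cmM IH cmU mulnS eq_sym.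
Qed.

Lemma eq_expcm_xi1 i (m : mon) a : (mmul (ucm i) m == expcmn (xi 1) a) =
  [&& i == 0%N, (0 < a)%N & m == expcmn (xi 1) a.-1].
Proof.
apply/eqP/and3P => [h|[/eqP -> a0 /eqP ->]]; last first.
  by rewrite -expcmnS prednK.
have E j : (((i == j) : nat) + m j = (j == 0) * a)%N.
  by rewrite -expcm_xi1E -h cmM cmU.
have i0 : i = 0%N by have := E i; rewrite eqxx; case: eqP.
split; first by rewrite i0.
  by have := E i; rewrite eqxx; case: a {h E} => //; rewrite muln0.
apply/eqP/eqP/cmP => j; rewrite expcm_xi1E.
by have := E j; rewrite i0 eq_sym; case: eqP => _; lia.
Qed.

Lemma mev_lgen m a : (mev lgen m)`_a = (m == expcmn (xi 1) a)%:R.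
Proof.
elim/mon_ind: m a => [|i m IH] a.
  rewrite mev1 coef1; congr (nat_of_bool _)%:R; apply/eqP/eqP => [->|] //.
  move=> /(congr1 (fun m : mon => m 0%N)); rewrite expcm_xi1E cm1; lia.
rewrite mevM mevU eq_expcm_xi1 /lgen; case: eqP => _ /=; last by rewrite mul0r coef0.
by rewrite coefXM; have [_|_] := posnP a; rewrite ?IH.
Qed.

Lemma mev_rgen m :
  mev (fun j => (rgen j)%:P) m = (if ht m == 0%N then << m >> else 0)%:P :> {poly P1}.
Proof.
elim/mon_ind: m => [|i m IH]; first by rewrite mev1 /ht wgt1 eqxx mpolyC1E polyC1.
rewrite mevM IH mevU -polyCM /ht wgtM wgtU addn_eq0; congr (_%:P).
rewrite /rgen; case: eqP => _ /=; last by rewrite mul0r.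
by case: eqP => _; rewrite ?mulr0 // mulUU.
Qed.

(** Values of [t] at [m] are multiples of 2^(ht m), and 2 = 0 in F_2. *)
Lemma steenrod_ht (t : steenrod) m : ht m != 0%N -> t m = 0.
Proof.
move=> h; have [c ->] := op_dvd2 t m; case: (ht m) h => // n _.
by rewrite expnS mulrnA two_F2 mul0rn.
Qed.

Lemma lsubstU c m : lsubst << c *g m >> = c%:MP%:P * mev lgen m.
Proof. exact: substU. Qed.

Lemma sq_substU p m :
  sq_subst << p *g m >> = lsubst p * (if ht m == 0%N then << m >> else 0)%:P.
Proof. by rewrite -mev_rgen; exact: substU. Qed.

(** Only the powers of xi_1 survive [lgen], and xi_1^a becomes T^a; so T separates the functionals
    Sq^a. *)
Lemma coef_lsubst a (p : P1) : (lsubst p)`_a = (ev (Sq 'F_2 a) p)%:MP.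
Proof.
rewrite (monalgE p) (rmorph_sum lsubst) (raddf_sum (ev _)) coef_sum raddf_sum.
apply: eq_bigr => m _; apply: etrans (congr1 malgC (esym (evU _ _ _))).
rewrite lsubstU coefCM mev_lgen SqE.
by case: (_ == _); rewrite ?mulr1 ?mulr0 ?raddf0.
Qed.

Lemma ev2_Sq a (t : steenrod) q : ev2 (Sq 'F_2 a) t q = ev t (sq_subst q)`_a.
Proof.
rewrite (monalgE q) (rmorph_sum sq_subst) (raddf_sum (ev2 _ _)) coef_sum raddf_sum.
apply: eq_bigr => m _; rewrite [LHS]ev2U sq_substU coefMC coef_lsubst.
rewrite [RHS]evZ; congr (_ * _).
by case: eqP => [_|/eqP h]; rewrite ?evU ?mul1r // raddf0 steenrod_ht.
Qed.

(** Turns left multiplication by all squares at once into a ring morphism, which is determined by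
    its values on the generators. *)
Lemma Sq_mulE a (t : steenrod) m :
  (Sq 'F_2 a * t) m = ev t (mev (sq_subst \o cop_gen 'F_2) m)`_a.
Proof. by rewrite -rmorph_mev -ev2_Sq /= conv.unlock. Qed.

(** * The action of the total square on Milnor's generators *)

Lemma pchar2_expD (R : comNzRingType) (x y : R) k : (2 : R) = 0 ->
  (x + y) ^+ (2 ^ k) = x ^+ (2 ^ k) + y ^+ (2 ^ k).
Proof.
move=> h; elim: k => [|k IH]; first by rewrite !expr1.
rewrite expnSr !exprM IH sqrrD -mulr_natr h mulr0 addr0 //.
Qed.

(** The inner series is x + T x^2 and the outer one has only exponents 2^k. By Frobenius (x + T
    x^2)^(2^k) = x^(2^k) + T^(2^k) x^(2^(k+1)), so only k = n+1 and k = n reach x^(2^(n+1)), the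
    term of index 2^(n+1) - 2. *)
Lemma scomp_quadratic (R : comNzRingType) (T : R) (w : nat -> R) n :
  (2 : R) = 0 -> (forall j, ones j.+2 != 1%N -> w j = 0) ->
  scomp (fun j => if j == 0%N then T else 0) w (2 ^ n.+1 - 2) =
  scoef w (2 ^ n.+1) + scoef w (2 ^ n) * T ^+ (2 ^ n).
Proof.
move=> h2 hw; rewrite /scomp (_ : (2 ^ n.+1 - 2).+2 = 2 ^ n.+1)%N; last first.
  by have := expn_gt0 2 n; rewrite expnS; lia.
have N2 : (2 <= 2 ^ n.+1)%N by have := expn_gt0 2 n; rewrite expnS; lia.
set v := fun _ => _; rewrite comp_low_coef ?series0 //.
have -> : series v (2 ^ n.+1) = 'X + T%:P * 'X^2.
  apply/polyP => i; rewrite coef_poly coefD coefX coefCM coefXn ltnS.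
  case: i => [|[|[|i]]] //=.
  - by rewrite mulr0 addr0.
  - by rewrite mulr0 addr0 (leq_trans _ N2).
  - by rewrite N2 mulr1 add0r.
  by rewrite mulr0 addr0 if_same.
have qk k : (('X + T%:P * 'X^2) ^+ (2 ^ k))`_(2 ^ n.+1)
    = (k == n.+1)%:R + T ^+ (2 ^ k) * (k == n)%:R.
  have h2p : (2 : {poly R}) = 0 by rewrite -polyC_natr h2.
  rewrite pchar2_expD // exprMn -polyC_exp -exprM -expnS coefD coefCM !coefXn.
  by rewrite !pow2_eq eqSS ![_ == k]eq_sym.
have w0 i : ones i != 1%N -> scoef w i = 0.
  by case: i => [|[|i]] //=; [rewrite ones1 | exact: hw].
have lt1 : (2 ^ n < (2 ^ n.+1).+1)%N by rewrite ltnS leq_exp2l.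
rewrite (bigD1 (Ordinal (ltnSn _))) //= (bigD1 (Ordinal lt1)) /=; last first.
  by rewrite -val_eqE /= pow2_eq ltn_eqF.
rewrite !qk !coef_poly ltnSn lt1 !eqxx [n == n.+1]ltn_eqF // [n.+1 == n]gtn_eqF //.
rewrite mulr0 addr0 add0r !mulr1 addrA big1 ?addr0 // => -[i hi] /andP[/= i1 i2].
(* An exponent that is not a power of 2 has outer coefficient 0; any other power of 2 is excluded by
   [qk]. *)
have [/ones_eq1[k E]|/w0 E] := eqVneq (ones i) 1%N; last first.
  by rewrite coef_poly E if_same mul0r.
move: i1 i2; rewrite -!val_eqE /= E !pow2_eq qk => /negbTE -> /negbTE ->.
by rewrite mulr0 addr0 mulr0.
Qed.

Lemma two_P1 : (2 : P1) = 0.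
Proof. by rewrite -mpolyC_nat (_ : 2%:R = 0 :> 'F_2) ?raddf0 //; exact/val_inj. Qed.

(** Milnor's coproduct sum_i xi_(n+1-i)^(2^i) (x) xi_i, where only the left factors 1 and xi_1^(2^n)
    survive. *)
Lemma mev_sq_xi n : mev (sq_subst \o cop_gen 'F_2) (xi n.+1) =
  << xi n.+1 >>%:P + << xi n >>%:P * 'X^(2 ^ n) :> {poly P1}.
Proof.
rewrite mevU /= -[subst _ _ _]/(sq_subst _) /cop_gen rmorph_scomp.
have rg k : (rgen (2 ^ k.+1 - 2))%:P = << xi k.+1 >>%:P :> {poly P1}.
  by have := mev_rgen (xi k.+1); rewrite mevU ht_xi eqxx.
have h2 : (2 : {poly P1}) = 0 by rewrite -polyC_natr two_P1.
have e2 k : (2 ^ k.+1 = (2 ^ k.+1 - 2).+2)%N.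
  by have := expn_gt0 2 k; rewrite expnS; lia.
transitivity (scomp lgen (fun j => (rgen j)%:P) (2 ^ n.+1 - 2)).
  apply: eq_scomp => j /=; last exact: subst_gen.
  apply: etrans (substC _ _ _) _; exact: subst_gen.
rewrite scomp_quadratic //; last first.
  move=> j hj; rewrite /rgen -subn1 subn_eq0 leq_eqVlt (negbTE hj) ltnS leqNgt.
  by rewrite ones_gt0.
have sc k : scoef (fun j => (rgen j)%:P) (2 ^ k.+1) = << xi k.+1 >>%:P :> {poly P1}.
  by rewrite -rg [in LHS]e2; exact: erefl.
rewrite sc; congr (_ + _ * _); case: n => [|n]; last exact: sc.
by rewrite expn0 -[xi 0]/mone mpolyC1E polyC1.
Qed.

(** Leading term for a formal degree [d]: [c] may be 0, which makes the notion multiplicative over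
    every commutative ring. *)
Definition top_coef (A : comNzRingType) (p : {poly A}) (d : nat) (c : A) :=
  (size p <= d.+1)%N /\ p`_d = c.

Lemma top_coefM (A : comNzRingType) (p q : {poly A}) d e b c :
  top_coef p d b -> top_coef q e c -> top_coef (p * q) (d + e) (b * c).
Proof.
move=> [sp <-] [sq <-]; split.
  by apply: leq_trans (size_polyMleq _ _) _; lia.
have h : (d < (d + e).+1)%N by rewrite ltnS leq_addr.
rewrite coefM (bigD1 (Ordinal h)) //= addKn big1 ?addr0 // => -[i /= hi].
rewrite -val_eqE /= => id; have [lt|gt] : (d < i)%N \/ (e < d + e - i)%N by lia.
  by rewrite [p`_i]nth_default ?mul0r //; apply: leq_trans sp lt.
by rewrite [q`_(_ - _)]nth_default ?mulr0 //; apply: leq_trans sq gt.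
Qed.

Lemma top_coefX (A : comNzRingType) (p : {poly A}) d c n :
  top_coef p d c -> top_coef (p ^+ n) (n * d) (c ^+ n).
Proof.
move=> h; elim: n => [|n IH]; last by rewrite !exprS mulSn; apply: top_coefM.
by rewrite !expr0; split; rewrite ?size_poly1 ?coef1.
Qed.

Lemma mev_expcmn (R : comNzRingType) (v : nat -> R) m n :
  mev v (expcmn m n) = mev v m ^+ n.
Proof. by elim: n => [|n IH]; rewrite ?mev1 // expcmnS mevM IH exprS. Qed.

Fixpoint xi_mon (i : nat) (R : seq nat) : mon :=
  if R is r :: R' then mmul (expcmn (xi i) r) (xi_mon i.+1 R') else mone.

(** The T-degree of the image of [xi_mon i.+1 R], each factor xi_(i+1) contributing 2^i. *)
Fixpoint pow2_weight (i : nat) (R : seq nat) : nat :=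
  if R is r :: R' then (r * 2 ^ i + pow2_weight i.+1 R')%N else 0%N.

Lemma top_coef_xi_mon i R :
  top_coef (mev (sq_subst \o cop_gen 'F_2) (xi_mon i.+1 R))
    (pow2_weight i R) << xi_mon i R >>.
Proof.
elim: R i => [|r R IH] i.
  by rewrite mev1 /= mpolyC1E; split; rewrite ?size_poly1 ?coef1.
rewrite /= mevM mev_expcmn -mulUU -mev_gen mev_expcmn mev_gen.
apply: top_coefM (IH _); apply: top_coefX; rewrite mev_sq_xi.
have h := expn_gt0 2 i; split; last first.
  by rewrite coefD coefC coefCM coefXn eqxx mulr1 gtn_eqF ?add0r.
apply: leq_trans (size_polyD _ _) _; rewrite geq_max.
rewrite (leq_trans (size_polyC_leq1 _)) //=.
apply: leq_trans (size_polyMleq _ _) _.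
by rewrite size_polyXn addnS -[X in (_ <= X)%N]add1n leq_add2r size_polyC_leq1.
Qed.

Lemma xi_mon0 R : xi_mon 0 R = xi_mon 1 (behead R).
Proof.
case: R => // r R /=; elim: r => [|r IH]; first exact: mul1m.
by rewrite expcmnS -mulmA IH; exact: mul1m.
Qed.

Lemma pow2_weightS i R : pow2_weight i.+1 R = (pow2_weight i R).*2.
Proof.
by elim: R i => //= r R IH i; rewrite IH doubleD expnS mulnCA mul2n.
Qed.

Lemma Sq_mul_gt a (t : steenrod) R : (pow2_weight 0 R < a)%N ->
  (Sq 'F_2 a * t) (xi_mon 1 R) = 0.
Proof.
move=> h; have [sz _] := top_coef_xi_mon 0 R.
by rewrite Sq_mulE nth_default ?raddf0 //; apply: leq_trans sz h.
Qed.

(** The recursion of the triangular pairing: the leading term lowers every index by one, so xi_1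
    becomes xi_0 = 1 and the first exponent drops out together with the first square. *)
Lemma Sq_mul_top (t : steenrod) R :
  (Sq 'F_2 (pow2_weight 0 R) * t) (xi_mon 1 R) = t (xi_mon 1 (behead R)).
Proof.
have [_ E] := top_coef_xi_mon 0 R.
by rewrite Sq_mulE E evU mul1r xi_mon0.
Qed.

(* The exponents of the xi-monomial of Milnor's triangular pairing: for w = a_1 a_2
   ... admissible, that of xi_i is a_i - 2 a_(i+1). *)
Fixpoint milnor_exps (w : word) : seq nat :=
  if w is a :: w' then (a - (head 0 w').*2)%N :: milnor_exps w' else [::].

(** The sum of the 2^i (a_i - 2 a_(i+1)) telescopes; admissibility keeps the subtractions from
    truncating. *)
Lemma pow2_weight_milnor w : admissible w -> pow2_weight 0 (milnor_exps w) = head 0%N w.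
Proof.
elim: w => //= a w IH h; rewrite muln1 pow2_weightS IH; last exact: path_sorted h.
case: w h {IH} => [|b w] h /=; first by lia.
by have /andP[h' _] : (b.*2 <= a)%N && admissible (b :: w) := h; lia.
Qed.

Lemma sqword_cons K a w : sqword K (a :: w) = Sq K a * sqword K w.
Proof. exact: big_cons. Qed.

Lemma sqword_milnor w : admissible w ->
  sqword 'F_2 w (xi_mon 1 (milnor_exps w)) = 1.
Proof.
elim: w => [|a w IH] h.
  have E : (1 : steenrod) mone = fone mone := op_dual1 _ mone.
  by rewrite /sqword big_nil [LHS]E /fone eqxx.
rewrite sqword_cons -[in Sq _ a](pow2_weight_milnor h : _ = a) Sq_mul_top IH //.
exact: path_sorted h.
Qed.

(** Compare first letters: a larger one in [w'] exceeds the T-degree and gives 0, a smaller one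
    settles the order, and equal ones are stripped by [Sq_mul_top]. *)
Lemma sqword_milnor_lex w w' : admissible w -> 0%N \notin w' ->
  sqword 'F_2 w' (xi_mon 1 (milnor_exps w)) != 0 ->
  (w' <= w :> seqlexi nat)%O.
Proof.
elim: w' w => [|a' w' IH] w h; first by rewrite Order.SeqLexiOrder.Exports.lexi0s.
rewrite in_cons negb_or eq_sym -lt0n => /andP[a0 w0]; rewrite sqword_cons.
have [lt|le] := ltnP (pow2_weight 0 (milnor_exps w)) a'.
  by rewrite Sq_mul_gt ?eqxx.
(* For empty [w] the T-degree is 0, below any letter of [w']. *)
case: w h le => [|a w] h; first by rewrite leqn0 => /eqP E; rewrite E in a0.
rewrite pow2_weight_milnor // => le; have leO : (a' <= a)%O := le.
rewrite Order.SeqLexiOrder.Exports.lexi_cons leO => nz /=; apply/implyP => le'.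
have E : a' = pow2_weight 0 (milnor_exps (a :: w)).
  by rewrite pow2_weight_milnor //; apply/eqP; rewrite eqn_leq le.
rewrite E Sq_mul_top in nz; apply: IH => //; exact: path_sorted h.
Qed.

(** * Linear independence of the admissible words *)

Lemma op_addE K (s t : opalg K) m : (s + t) m = s m + t m.
Proof. by []. Qed.

Lemma op_subE K (s t : opalg K) m : (s - t) m = s m - t m.
Proof. by []. Qed.

Lemma op_sumE (K : comNzRingType) I (r : seq I) (F : I -> opalg K) m :
  (\sum_(i <- r) F i) m = \sum_(i <- r) F i m.
Proof. by elim: r => [|i r IH]; rewrite ?big_nil // !big_cons op_addE IH. Qed.

Lemma seq_lex_min (s : seq word) : s != [::] ->
  exists2 w, w \in s & forall w', w' \in s -> (w <= w' :> seqlexi nat)%O.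
Proof.
elim: s => // w [|v s] IH _.
  by exists w => [|w']; rewrite inE // => /eqP ->.
have [//|u us min] := IH; have [le|lt] := Order.TotalTheory.leP (w : seqlexi nat) u.
  exists w => [|w']; rewrite inE ?eqxx // => /predU1P[-> //|/min].
  exact: Order.le_trans.
exists u => [|w']; rewrite inE ?us ?orbT // => /predU1P[->|/min //].
exact: Order.POrderTheory.ltW.
Qed.

(** On the Milnor monomial of the lexicographically smallest word of [x], that word takes the value
    1 and all others vanish. *)
Lemma admissible_free (x : wsum) :
  (forall w, w \in msupp x -> admissible w /\ 0%N \notin w) ->
  realize 'F_2 x = 0 -> x = 0.
Proof.
move=> hx; rewrite /realize => E.
have [e|nz] := eqVneq (enum_fset (msupp x)) [::].
  by apply/malgP => w; rewrite mcoeff0 mcoeff_outdom // -[_ \in _]/(_ \in enum_fset _) e.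
have [w wx min] := seq_lex_min nz.
have [aw _] := hx w wx.
have /eqP := congr1 (fun s : steenrod => s (xi_mon 1 (milnor_exps w))) E.
rewrite op_sumE (big_fsetD1 w) //= sqword_milnor // big_seq big1 ?addr0 ?oner_eq0 //.
move=> w'; rewrite in_fsetD1 => /andP[ne w'x]; apply/eqP/negPn/negP => nz'.
have [_ z] := hx w' w'x; have le := sqword_milnor_lex aw z nz'.
have E' := Order.POrderTheory.le_anti (x := w : seqlexi nat) (y := w').
by move: ne; rewrite E' ?eqxx // le min.
Qed.

(** * Formal sums of words and their tracked reduction *)

(** Forgets multiplicities modulo 2, whereas the sum of the lifts of [B] in Z/4 still sees them
    modulo 4. *)
Definition word_sum (B : seq word) : wsum := \sum_(v <- B) << v >>.

Lemma steenrod_addrr (s : steenrod) : s + s = 0.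
Proof. by apply: opalgP => m; rewrite op_addE -mulr2n two_F2. Qed.

Lemma wsum_addrr (x : wsum) : x + x = 0.
Proof. by apply/malgP => v; rewrite mcoeffD mcoeff0 -mulr2n two_F2. Qed.

Lemma F2_natr_eq0 n : (n%:R == 0 :> 'F_2) = ~~ odd n.
Proof.
rewrite -[n in LHS]odd_double_half -mul2n natrD natrM.
by rewrite (_ : 2%:R = 0 :> 'F_2) ?mul0r ?addr0; [case: (odd n) | exact/val_inj].
Qed.

Lemma mcoeff_word_sum B v : (word_sum B)@_v = (count_mem v B)%:R.
Proof.
rewrite /word_sum raddf_sum /=.
elim: B => [|w B IH]; rewrite ?big_nil // big_cons IH mcoeffU natrD //.
Qed.

Lemma mem_word_sum B v : (v \in msupp (word_sum B)) = odd (count_mem v B).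
Proof. by rewrite -mcoeff_neq0 mcoeff_word_sum F2_natr_eq0 negbK. Qed.

Lemma word_sum_cat B C : word_sum (B ++ C) = word_sum B + word_sum C.
Proof. exact: big_cat. Qed.

Lemma word_sum1 w : word_sum [:: w] = << w >>.
Proof. exact: big_seq1. Qed.

Lemma word_sum_msupp (x : wsum) : word_sum (enum_fset (msupp x)) = x.
Proof.
rewrite [RHS]monalgE /word_sum !big_seq; apply: eq_bigr => w.
rewrite -mcoeff_neq0 => h; congr << _ *g _ >>.
by case: (x@_w) h => [[|[|?]]] //= ? _; apply/val_inj.
Qed.

Lemma realize_word_sum K B : realize K (word_sum B) =
  \sum_(v <- undup B) sqword K v *+ odd (count_mem v B).
Proof.
rewrite /realize [RHS](bigID (fun v => odd (count_mem v B))) /=.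
rewrite [X in _ + X]big1 ?addr0; last by move=> v /negbTE ->; rewrite mulr0n.
rewrite -big_filter -[RHS]big_filter filter_predT.
transitivity (\sum_(v <- [seq v <- undup B | odd (count_mem v B)]) sqword K v).
  apply: perm_big; apply: uniq_perm; rewrite ?filter_uniq ?undup_uniq ?fset_uniq //.
  move=> v; rewrite mem_filter mem_undup [LHS]mem_word_sum.
  by case: (boolP (v \in B)) => [_|/count_memPn ->]; rewrite ?andbT.
by rewrite !big_filter; apply: eq_bigr => v ->.
Qed.

Lemma big_undup_count (V : nmodType) (B : seq word) (F : word -> V) :
  \sum_(v <- undup B) F v *+ count_mem v B = \sum_(v <- B) F v.
Proof. by rewrite -[RHS]big_undup_iterop_count. Qed.

Lemma realize_uniq K B : uniq B ->
  realize K (word_sum B) = \sum_(v <- B) sqword K v.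
Proof.
move=> u; rewrite realize_word_sum undup_id // !big_seq; apply: eq_bigr => v vB.
by rewrite count_uniq_mem // vB.
Qed.

Lemma realize_word_sum2 B :
  realize 'F_2 (word_sum B) = \sum_(v <- B) sqword 'F_2 v.
Proof.
rewrite realize_word_sum -[RHS]big_undup_count; apply: eq_bigr => v _.
rewrite -[in RHS](odd_double_half (count_mem v B)) mulrnDr -mul2n mulrnA.
by rewrite mulr2n steenrod_addrr mul0rn addr0.
Qed.

Lemma realize2D x y : realize 'F_2 (x + y) = realize 'F_2 x + realize 'F_2 y.
Proof.
rewrite -(word_sum_msupp x) -(word_sum_msupp y) -word_sum_cat.
by rewrite !realize_word_sum2 big_cat.
Qed.

Lemma realize2_sum I (r : seq I) (F : I -> wsum) :
  realize 'F_2 (\sum_(i <- r) F i) = \sum_(i <- r) realize 'F_2 (F i).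
Proof.
elim: r => [|i r IH]; last by rewrite !big_cons realize2D IH.
by rewrite !big_nil /realize msupp0 big_seq_fset0.
Qed.

Lemma D0_mulr4n (x : D0) : x *+ 4 = 0.
Proof.
apply: opalgP => m; rewrite -[LHS]/(x m *+ 4).
by rewrite -mulr_natr (_ : 4%:R = 0 :> 'Z_4) ?mulr0 //; exact/val_inj.
Qed.

(** The second list has the shape of [cancelled], and each of its summands is the boundary of a
    [mu0] term. *)
Lemma realize4_word_sum B : realize 'Z_4 (word_sum B) =
  \sum_(v <- B) sqword 'Z_4 v +
  \sum_(v <- flatten [seq nseq (count_mem v B)./2 v | v <- undup B])
    sqword 'Z_4 v *+ 2.
Proof.
rewrite realize_word_sum -[X in _ = X + _]big_undup_count big_flatten big_map.
rewrite -big_split; apply: eq_bigr => v _ /=.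
rewrite big_nseq iter_addr_0 -mulrnA -mulrnDr.
set c := count_mem v B; have -> : (c + 2 * c./2 = odd c + 4 * c./2)%N by lia.
by rewrite mulrnDr mulrnA D0_mulr4n mul0rn addr0.
Qed.

(** * Words under rewriting and their traces *)

Lemma sqword_cat K v w : sqword K (v ++ w) = sqword K v * sqword K w.
Proof. exact: big_cat. Qed.

Lemma Sq0 K : Sq K 0 = 1.
Proof. exact: erefl. Qed.

Lemma sqword_tail2 K k w : sqword K (tail2 k w) = Sq K k * sqword K w.
Proof. by rewrite /tail2; case: eqP => [->|_]; rewrite ?Sq0 ?mul1r // sqword_cons. Qed.

(** Serves twice: over Z/4 for the boundary of one track summand, over F_2 for the Adem relation. *)
Lemma sqword_bad_pair K w al a b be : bad_pair w = Some (al, a, b, be) ->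
  sqword K al * (bracket K a b * sqword K be) =
  sqword K w + \sum_(v <- rewrites w) sqword K v.
Proof.
move=> E; have [Ew _] := bad_pairP E; rewrite /rewrites E big_map.
rewrite {1}Ew sqword_cat !sqword_cons /bracket mulrDl mulrDr !mulrA; congr (_ + _).
rewrite -mulrA mulr_suml mulr_sumr; apply: eq_bigr => k _.
by rewrite sqword_cat sqword_cons sqword_tail2 !mulrA.
Qed.

Lemma rewrites_nonzero w v : 0%N \notin w -> v \in rewrites w -> 0%N \notin v.
Proof.
rewrite /rewrites; case E: (bad_pair w) => [[[[al a] b] be]|] //.
have [-> ab] := bad_pairP E => w0 /mapP[k]; rewrite mem_filter mem_iota => /andP[_ hk] ->.
move: w0; rewrite !mem_cat !inE !negb_or => /and4P[-> a0 b0 be0] /=.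
apply/andP; split; first by lia.
by rewrite /tail2; case: eqP => // /eqP k0; rewrite inE negb_or eq_sym k0.
Qed.

Lemma bad_pair_gt0 w al a b be : 0%N \notin w ->
  bad_pair w = Some (al, a, b, be) -> (0 < a < b.*2)%N.
Proof.
move=> w0 E; have [Ew ->] := bad_pairP E; move: w0.
by rewrite Ew mem_cat !inE !negb_or => /and3P[_ a0 _]; rewrite lt0n eq_sym a0.
Qed.

Lemma moment_ind (P : word -> Prop) :
  (forall w, (forall v, v \in rewrites w -> P v) -> P w) -> forall w, P w.
Proof.
move=> h w; have [n] := ubnP (moment w); elim: n w => // n IH w; rewrite ltnS => hw.
by apply: h => v vw; apply: IH; apply: leq_trans hw; apply: rewrites_moment.
Qed.

(** Each intermediate word occurs once in the relation that creates it and once at the head of its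
    own trace; these cancel, leaving the start and the end of the reduction. *)
Lemma word_sum_trace w : word_sum (trace w) = << w >> + adm w.
Proof.
elim/moment_ind: w => w IH; rewrite traceE admE; case: ifP => aw.
  by rewrite wsum_addrr /word_sum big_nil.
rewrite -cat1s !word_sum_cat word_sum1; congr (_ + _).
rewrite /word_sum big_flatten big_map -[X in _ + X = _]/(\sum_(v <- _) word_sum _).
rewrite -big_split !big_seq; apply: eq_bigr => v vw /=.
by rewrite IH // addrA wsum_addrr add0r.
Qed.

Definition trace_sum (x : wsum) : seq word :=
  flatten [seq trace w | w <- enum_fset (msupp x)].

Lemma word_sum_trace_sum x : word_sum (trace_sum x) = x + Adm x.
Proof.
rewrite -[X in X + _]word_sum_msupp /word_sum /trace_sum big_flatten big_map.
rewrite /Adm -big_split.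
by apply: eq_bigr => w _; exact: word_sum_trace.
Qed.

Lemma bad_pair_admissible w : bad_pair w = None -> admissible w.
Proof. by rewrite -bad_pairN => ->. Qed.

Lemma bad_pair_inadmissible w p : bad_pair w = Some p -> admissible w = false.
Proof. by rewrite -bad_pairN => ->. Qed.

Lemma msupp_adm w : 0%N \notin w ->
  forall v, v \in msupp (adm w) -> admissible v /\ 0%N \notin v.
Proof.
elim/moment_ind: w => w IH w0 v; rewrite admE; case: ifP => aw.
  by rewrite -mcoeff_neq0 mcoeffU; case: (w =P v) => [<-|_] //; rewrite mulr0n eqxx.
rewrite -mcoeff_neq0 raddf_sum /= => nz.
have /hasP[u uw] : has (fun u => v \in msupp (adm u)) (rewrites w).
  apply: contraNT nz => /hasPn h; rewrite big_seq big1 // => u /h.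
  by rewrite -mcoeff_neq0 negbK => /eqP.
by apply: IH => //; apply: rewrites_nonzero uw.
Qed.

Lemma realize_adm : (forall a b, (0 < a < b.*2)%N -> bracket 'F_2 a b = 0) ->
  forall w, 0%N \notin w -> realize 'F_2 (adm w) = sqword 'F_2 w.
Proof.
move=> br w; elim/moment_ind: w => w IH w0; rewrite admE.
case E: (bad_pair w) => [[[[al a] b] be]|]; last first.
  rewrite bad_pair_admissible // -word_sum1.
  by rewrite realize_uniq ?big_seq1.
rewrite (bad_pair_inadmissible E) realize2_sum.
transitivity (\sum_(v <- rewrites w) sqword 'F_2 v).
  rewrite !big_seq; apply: eq_bigr => v vw; apply: IH => //.
  exact: rewrites_nonzero vw.
have := sqword_bad_pair 'F_2 E; rewrite (br _ _ (bad_pair_gt0 w0 E)) mul0r mulr0.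
by move=> E0; apply: (addrI (sqword 'F_2 w)); rewrite -E0 steenrod_addrr.
Qed.

(** * Boundaries of tracks *)

Lemma bdD x y : bd (x + y) = bd x + bd y.
Proof. exact: raddfD (val : RD -> D0) _ _. Qed.

Lemma bd_sum I (r : seq I) (F : I -> D1) :
  bd (\sum_(i <- r) F i) = \sum_(i <- r) bd (F i).
Proof. by elim: r => [|i r IH]; rewrite ?big_nil // !big_cons bdD IH. Qed.

Lemma pi_Sq a : pi (Sq 'Z_4 a) = Sq 'F_2 a.
Proof.
apply: opalgP => m; rewrite -[LHS]/(red (Sq 'Z_4 a m)) !SqE.
by case: (_ == _); rewrite ?rmorph1 ?rmorph0.
Qed.

Lemma pi_bracket a b : pi (bracket 'Z_4 a b) = bracket 'F_2 a b.
Proof.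
rewrite rmorphD rmorphM rmorph_sum /= !pi_Sq; congr (_ + _).
by apply: eq_bigr => k _; rewrite rmorphM /= !pi_Sq.
Qed.

Section Boundary.
Variables (u : nat -> nat -> D1) (hu : secondary_adem_track u).

Lemma bracket2_eq0 a b : (0 < a < b.*2)%N -> bracket 'F_2 a b = 0.
Proof.
move=> /hu[h _]; rewrite -pi_bracket -h; exact/eqP/(RD_valP (u a b).2).
Qed.

Lemma bd_track w : 0%N \notin w -> bd (track u w) = \sum_(v <- trace w) sqword 'Z_4 v.
Proof.
elim/moment_ind: w => w IH w0.
case E: (bad_pair w) => [[[[al a] b] be]|]; last first.
  by rewrite traceE track_admissible bad_pair_admissible // big_nil.
rewrite traceE (bad_pair_inadmissible E) (trackE u E) bdD bd_sum.
(* The twist of the left action lies in the component from A, which [bd] discards. *)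
rewrite -[bd (lact _ _)]/(sqword 'Z_4 al * (bd (u a b) * sqword 'Z_4 be)).
have [-> _] := hu (bad_pair_gt0 w0 E).
rewrite (sqword_bad_pair _ E) big_cons big_cat -addrA; congr (_ + (_ + _)).
rewrite big_flatten big_map !big_seq; apply: eq_bigr => v vw; apply: IH => //.
exact: rewrites_nonzero vw.
Qed.

(** Coincidences between [x] and [Adm x] are among the cancelled pairs, so the right-hand side lifts
    the sum after its reduction modulo 2. *)
Lemma bd_corrected_track (x : wsum) : (forall w, w \in msupp x -> 0%N \notin w) ->
  bd (corrected_track u x) = realize 'Z_4 (x + Adm x).
Proof.
move=> hx; rewrite -word_sum_trace_sum realize4_word_sum bdD !bd_sum; congr (_ + _).
rewrite big_flatten big_map !big_seq; apply: eq_bigr => w wx.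
by rewrite bd_track //; apply: hx.
Qed.

End Boundary.

(** * Degrees *)

Section Homogeneous.

(** The shift [k] records the degrees removed by cap products, and the shift by one of the copy of A
    in [D1], without subtraction in [nat]. *)
Definition shifted_homog (K : comNzRingType) (k d : nat) (s : opalg K) :=
  forall m, s m != 0 -> (deg m + k = d)%N.

Lemma homogE (K : comNzRingType) d (s : opalg K) :
  homog d s <-> shifted_homog 0 d s.
Proof. by split=> h m /h; rewrite addn0. Qed.

Lemma deg_expcmn m n : deg (expcmn m n) = (n * deg m)%N.
Proof. exact: wgt_expcmn. Qed.

Lemma deg_xi k : deg (xi k) = (2 ^ k - 1)%N.
Proof.
case: k => [|k]; first by rewrite /deg wgt1.
by rewrite [deg _]wgtU; have := expn_gt0 2 k; rewrite expnS; lia.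
Qed.

Lemma deg_eta k l : deg (eta k l) = (2 ^ k + 2 ^ l - 1)%N.
Proof.
by rewrite [deg _]wgtU; have := expn_gt0 2 k; have := expn_gt0 2 l; lia.
Qed.

Variable K : comNzRingType.
Implicit Types (s t : opalg K).

Lemma shifted_homog0 k d : shifted_homog k d (0 : opalg K).
Proof. by move=> m; rewrite eqxx. Qed.

Lemma shifted_homogD k d s t :
  shifted_homog k d s -> shifted_homog k d t -> shifted_homog k d (s + t).
Proof.
move=> hs ht m; rewrite op_addE.
by have [->|/hs //] := eqVneq (s m) 0; rewrite add0r => /ht.
Qed.

Lemma shifted_homog_sum k d I (r : seq I) (P : pred I) (F : I -> opalg K) :
  (forall i, P i -> shifted_homog k d (F i)) ->
  shifted_homog k d (\sum_(i <- r | P i) F i).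
Proof.
by move=> h; apply: big_ind => //; [exact: shifted_homog0 | exact: shifted_homogD].
Qed.

Lemma shifted_homogM k l d e s t :
  shifted_homog k d s -> shifted_homog l e t -> shifted_homog (k + l) (d + e) (s * t).
Proof.
move=> hs ht m /conv_support[m1 [m2 [<- /hs <- /ht <-]]]; exact: addnACA.
Qed.

Lemma shifted_homog_cap k d m0 s :
  shifted_homog k d s -> shifted_homog (k + deg m0) d (op_cap m0 s).
Proof. by move=> h m /h <-; rewrite /deg wgtM; lia. Qed.

Lemma shifted_homog_dual m0 : shifted_homog 0 (deg m0) (op_dual K m0).
Proof.
move=> m; rewrite -[op_dual _ _ _]/((m == m0)%:R *+ 2 ^ ht m0).
by case: (m =P m0) => [-> _|_]; rewrite ?addn0 // mul0rn eqxx.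
Qed.

Lemma homog_Sq a : homog a (Sq K a).
Proof.
apply/homogE; have := @shifted_homog_dual (expcmn (xi 1) a).
by rewrite deg_expcmn deg_xi muln1.
Qed.

Lemma homog_sqword w : homog (sumn w) (sqword K w).
Proof.
apply/homogE; elim: w => [|a w IH].
  by rewrite /sqword big_nil -Sq0; apply/homogE/homog_Sq.
by rewrite sqword_cons; apply: (@shifted_homogM 0 0) IH; apply/homogE/homog_Sq.
Qed.

End Homogeneous.

Lemma shifted_homog_pi d s : homog d s -> shifted_homog 0 d (pi s).
Proof.
move=> h m nz; rewrite addn0; apply: h; apply: contraNneq nz => E.
by rewrite -[pi s m]/(red (s m)) E rmorph0.
Qed.

Lemma shifted_homog_halve k d (s : D0) :
  shifted_homog k d s -> shifted_homog k d (op_halve s).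
Proof.
move=> h m nz; apply: h; apply: contraNneq nz => E.
rewrite -[op_halve s m]/(if ht m == 0%N then halve (s m) else 0) E.
by case: ifP => // _; apply/eqP/val_inj.
Qed.

(** Capping with xi_1 costs degree 1. In the double-index terms the caps cost 2^(k+i) + 2^(l+j) - 1
    in all, and the dual of xi_(k+i) xi_(l+j) restores all but 1. *)
Lemma twist_homog d e a (r : RD) : shifted_homog 0 d a -> homog e (r : D0) ->
  shifted_homog 1 (d + e) (twist a r).
Proof.
move=> ha /homogE hr; apply: shifted_homogD.
  have := shifted_homogM (shifted_homog_cap (m0 := xi 1) ha) (shifted_homog_halve hr).
  by rewrite deg_xi.
apply: shifted_homog_sum => k _; apply: shifted_homog_sum => l _.
apply: shifted_homog_sum => i _; apply: shifted_homog_sum => j _.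
set A := mmul _ _; set B := mmul _ _ => m /(shifted_homogM (@shifted_homog_dual _ A)
  (shifted_homogM (shifted_homog_cap (m0 := B) ha)
     (shifted_homog_halve (shifted_homog_cap (m0 := eta k l) hr)))).
rewrite deg_eta [deg A]wgtM [deg B]wgtM -!/(deg _) !deg_expcmn !deg_xi !expnD !mulnBr.
(* These bounds make the truncated differences 2^k 2^i - 2^k and 2^l 2^j - 2^l exact. *)
have := leq_pmulr (2 ^ k) (expn_gt0 2 i : (0 < 2 ^ i)%N).
have := leq_pmulr (2 ^ l) (expn_gt0 2 j : (0 < 2 ^ j)%N).
have := expn_gt0 2 k; have := expn_gt0 2 l; lia.
Qed.

Lemma homog1E d x :
  homog1 d x <-> shifted_homog 1 d x.1 /\ shifted_homog 0 d (bd x).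
Proof.
have E (s : steenrod) : shifted_homog 1 d s <-> forall m, s m != 0 -> (deg m).+1 = d.
  by split=> h m /h; rewrite addn1.
by rewrite /homog1 -homogE E.
Qed.

Lemma homog1_0 d : homog1 d 0.
Proof. by split=> m; rewrite eqxx. Qed.

Lemma homog1D d x y : homog1 d x -> homog1 d y -> homog1 d (x + y).
Proof.
move=> /homog1E[h1 h2] /homog1E[h3 h4]; apply/homog1E.
by rewrite bdD; split; apply: shifted_homogD.
Qed.

Lemma homog1_sum d I (r : seq I) (F : I -> D1) (P : pred I) :
  (forall i, P i -> homog1 d (F i)) -> homog1 d (\sum_(i <- r | P i) F i).
Proof. by move=> h; apply: big_ind => // x y; exact: homog1D. Qed.

Lemma homog1_lact d e s x : homog d s -> homog1 e x -> homog1 (d + e) (lact s x).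
Proof.
move=> hs /homog1E[h1 h2]; have hp := shifted_homog_pi hs; apply/homog1E; split.
  apply: shifted_homogD; last by apply: twist_homog => //; apply/homogE.
  exact: (@shifted_homogM _ 0 1).
by apply: (@shifted_homogM _ 0 0) h2; apply/homogE.
Qed.

Lemma homog1_ract d e s x : homog d s -> homog1 e x -> homog1 (e + d) (ract x s).
Proof.
move=> hs /homog1E[h1 h2]; have hp := shifted_homog_pi hs; apply/homog1E; split.
  exact: (@shifted_homogM _ 1 0).
by apply: (@shifted_homogM _ 0 0) h2 _; apply/homogE.
Qed.

Lemma sumn_rewrites w v : v \in rewrites w -> sumn v = sumn w.
Proof.
rewrite /rewrites; case E: (bad_pair w) => [[[[al a] b] be]|] //.
have [-> ab] := bad_pairP E => /mapP[k]; rewrite mem_filter mem_iota => /andP[_ hk] ->.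
rewrite !sumn_cat /= /tail2; case: eqP => [k0|_] /=; lia.
Qed.

Lemma homog1_track u w : secondary_adem_track u -> 0%N \notin w ->
  homog1 (sumn w) (track u w).
Proof.
move=> hu; elim/moment_ind: w => w IH w0.
case E: (bad_pair w) => [[[[al a] b] be]|]; last first.
  by rewrite track_admissible ?bad_pair_admissible //; exact: homog1_0.
rewrite (trackE u E); apply: homog1D.
  have [Ew _] := bad_pairP E; have [_ h] := hu _ _ (bad_pair_gt0 w0 E).
  rewrite Ew sumn_cat /= [(a + _)%N]addnA; apply: homog1_lact; first exact: homog_sqword.
  by apply: homog1_ract => //; exact: homog_sqword.
rewrite big_seq; apply: homog1_sum => v vw; rewrite -(sumn_rewrites vw).
by apply: IH => //; apply: rewrites_nonzero vw.
Qed.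

Lemma mem_trace w v : v \in trace w -> sumn v = sumn w.
Proof.
elim/moment_ind: w v => w IH v; rewrite traceE; case: ifP => // _.
rewrite inE mem_cat => /predU1P[->//|/orP[/sumn_rewrites //|]].
by move=> /flattenP[s /mapP[v' v'w ->] /(IH _ v'w) ->]; exact: sumn_rewrites.
Qed.

Lemma homog1_mu0 d s : homog d s -> homog1 d (mu0 s).
Proof.
move=> h; split=> m; first by rewrite eqxx.
rewrite bd_mu0 -[(s *+ 2) m]/(s m *+ 2) => nz; apply: h.
by apply: contraNneq nz => ->; rewrite mul0rn.
Qed.

Lemma homog1_corrected_track u d (x : wsum) : secondary_adem_track u ->
  (forall w, w \in msupp x -> 0%N \notin w /\ sumn w = d) ->
  homog1 d (corrected_track u x).
Proof.
move=> hu hx; rewrite /corrected_track /track_sum.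
apply: homog1D; rewrite big_seq; apply: homog1_sum => w.
  by move=> /hx[w0 <-]; apply: homog1_track.
move=> /flattenP[s /mapP[v]]; rewrite mem_undup => /flattenP[t /mapP[w' /hx[_ <-] ->]].
move=> /mem_trace <- ->; rewrite mem_nseq => /andP[_ /eqP ->].
by apply: homog1_mu0; apply: homog_sqword.
Qed.

(** * Rows *)

(** Over Z/4 [realize] is not additive: a common word would cancel on the left and count twice on
    the right. *)
Lemma realize_disjoint K (x y : wsum) :
  (forall w, w \in msupp x -> w \notin msupp y) ->
  realize K (x + y) = realize K x + realize K y.
Proof.
move=> dis; rewrite -[in LHS](word_sum_msupp x) -[in LHS](word_sum_msupp y).
rewrite -word_sum_cat realize_uniq ?big_cat // cat_uniq !fset_uniq andbT /=.
by apply/hasPn => w wy; apply/negP => /dis; rewrite wy.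
Qed.

Lemma admissible_form_inj z x y :
  is_admissible_form z x -> is_admissible_form z y -> x = y.
Proof.
move=> [hx ex] [hy ey].
have E : x + y = 0.
  apply: admissible_free; last by rewrite realize2D ex ey steenrod_addrr.
  move=> w; rewrite -mcoeff_neq0 mcoeffD => nz.
  have [/hx //|] := boolP (w \in msupp x); rewrite -mcoeff_neq0 negbK => /eqP x0.
  by apply: hy; rewrite -mcoeff_neq0; rewrite x0 add0r in nz.
by rewrite -[x]addr0 -(wsum_addrr y) addrA E add0r.
Qed.

(** Independence of admissible words makes the choice in [admissible_lift] immaterial. *)
Lemma admissible_liftE z x : is_admissible_form z x ->
  admissible_lift z = realize 'Z_4 x.
Proof.
move=> hx; rewrite /admissible_lift; case: pselect => [h|[]]; last by exists x.
by rewrite (admissible_form_inj (svalP (cid h)) hx).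
Qed.

(** * Adem relations and right multiplication by Sq^1 *)

Section Adem.
Variables (u : nat -> nat -> D1) (hu : secondary_adem_track u).

Lemma realize_Adm (x : wsum) : (forall w, w \in msupp x -> 0%N \notin w) ->
  realize 'F_2 (Adm x) = realize 'F_2 x.
Proof.
move=> hx; rewrite realize2_sum [RHS]/realize !big_seq; apply: eq_bigr => w wx.
by rewrite (realize_adm (bracket2_eq0 hu)) //; apply: hx.
Qed.

Lemma msupp_Adm (x : wsum) : (forall w, w \in msupp x -> 0%N \notin w) ->
  forall w, w \in msupp (Adm x) -> admissible w /\ 0%N \notin w.
Proof.
move=> hx v; rewrite -mcoeff_neq0 raddf_sum /= => nz.
have /hasP[w wx] : has (fun w => v \in msupp (adm w)) (enum_fset (msupp x)).
  apply: contraNT nz => /hasPn h; rewrite big_seq big1 // => w /h.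
  by rewrite -mcoeff_neq0 negbK => /eqP.
by apply: msupp_adm; apply: hx.
Qed.

Lemma Sq1_Sq1 : Sq 'F_2 1 * Sq 'F_2 1 = 0.
Proof.
have := bracket2_eq0 hu (erefl : 0 < 1 < 1.*2)%N.
(* The only index k = 0 has coefficient C(0, 1) = 0. *)
by rewrite /bracket (_ : adem_idx 1 1 = [::]) // big_nil addr0.
Qed.

Lemma sqword_rcons K w a : sqword K (rcons w a) = sqword K w * Sq K a.
Proof. by rewrite -cats1 sqword_cat [X in _ * X]/sqword big_seq1. Qed.

(** A last letter other than 0 and 1 is at least 2 = 2 * 1. The default 0 of [last] includes the
    empty word, which gives Sq^1. *)
Lemma admissible_rcons1 w : admissible w -> 0%N \notin w -> last 0%N w != 1%N ->
  admissible (rcons w 1%N).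
Proof.
case: w => // a w; rewrite /admissible /= rcons_path => -> /= w0 l1.
have : last a w \in a :: w by exact: mem_last.
by case: (last a w) l1 => [|[|n]] // _ h; rewrite h in w0.
Qed.

(* Right multiplication by Sq^1 kills A Sq^1 and sends the admissible words not
   ending in Sq^1 to distinct admissible words. *)
Lemma admissible_last1 (y : wsum) b :
  (forall w, w \in msupp y -> admissible w /\ 0%N \notin w) ->
  realize 'F_2 y = b * Sq 'F_2 1 ->
  forall w, w \in msupp y -> last 0%N w = 1%N.
Proof.
move=> hy E w wy; apply/eqP/negPn/negP => w1.
pose s := [seq rcons v 1%N | v <- enum_fset (msupp y) & last 0%N v != 1%N].
have us : uniq s.
  by rewrite map_inj_in_uniq ?filter_uniq ?fset_uniq // => ? ? _ _ /rcons_inj[].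
have s0 : word_sum s = 0.
  apply: admissible_free => [v|].
    rewrite mem_word_sum count_uniq_mem // oddb => /mapP[v'].
    rewrite mem_filter => /andP[v1 /hy[av v0]] ->; split.
      exact: admissible_rcons1.
    by rewrite mem_rcons inE negb_or v0.
  rewrite realize_uniq // big_map big_filter.
  (* In this vanishing product the words of [y] ending in Sq^1 contribute 0, hence so do the others
     together. *)
  have : realize 'F_2 y * Sq 'F_2 1 = 0 by rewrite E -mulrA Sq1_Sq1 mulr0.
  rewrite /realize mulr_suml (bigID (fun v => last 0%N v != 1%N)) /=.
  rewrite [X in _ + X]big1 ?addr0 => [h|v].
    by rewrite -[RHS]h; apply: eq_bigr => v _; rewrite sqword_rcons.
  rewrite negbK; case/lastP: v => // v a; rewrite last_rcons => /eqP ->.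
  by rewrite sqword_rcons -mulrA Sq1_Sq1 mulr0.
have ws : rcons w 1%N \in s by apply: (map_f (rcons^~ 1%N)); rewrite mem_filter w1.
have : rcons w 1%N \in msupp (word_sum s) by rewrite mem_word_sum count_uniq_mem // ws.
by rewrite s0 msupp0 in_fset0.
Qed.

End Adem.

(** * Row maps and row words *)

Section Rows.
Variable K : comNzRingType.

Lemma row_mapD (x y : freemod K) : row_map (x + y) = row_map x + row_map y.
Proof. exact: (raddfD (mmap idfun (Sq K))). Qed.

Lemma row_mapU s c : row_map (<< s *g c >> : freemod K) = s * Sq K c.
Proof. by rewrite -[row_map _]/(mmap idfun (Sq K) _) [LHS]mmapU. Qed.

Lemma row_map_sum I (r : seq I) (F : I -> freemod K) :
  row_map (\sum_(i <- r) F i) = \sum_(i <- r) row_map (F i).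
Proof. exact: (raddf_sum (mmap idfun (Sq K))). Qed.

Lemma row_map_homog d (x : freemod K) : homog_mod d x -> shifted_homog 0 d (row_map x).
Proof.
move=> hx; rewrite /row_map big_seq; apply: shifted_homog_sum => c _.
move=> m /conv_support[m1 [m2 [<- /hx <- /homog_Sq <-]]]; exact: addn0.
Qed.

Lemma mcoeff_realize_mod (a : {malg wsum[nat]}) c : (realize_mod K a)@_c = realize K a@_c.
Proof.
rewrite /realize_mod raddf_sum /=.
have [ca|ca] := boolP (c \in msupp a).
  rewrite (big_fsetD1 c) //= mcoeffUU big_seq big1 ?addr0 // => c'.
  by rewrite in_fsetD1 => /andP[/negbTE ne _]; rewrite mcoeffU ne.
rewrite big_seq big1 => [|c' c'a]; last first.
  by rewrite mcoeffU; case: (c' =P c) => // E; rewrite E (negbTE ca) in c'a.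
by rewrite (mcoeff_outdom ca) /realize msupp0 big_seq_fset0.
Qed.

Lemma msupp_realize_mod (a : {malg wsum[nat]}) :
  {subset msupp (realize_mod K a) <= msupp a}.
Proof.
move=> c; rewrite -mcoeff_neq0 mcoeff_realize_mod; apply: contraNT => ca.
by rewrite (mcoeff_outdom ca) /realize msupp0 big_seq_fset0.
Qed.

(** A word [rcons w c] determines [w] and [c], so no two row words collide and the identity also
    holds for the word lifts to Z/4. *)
Lemma row_map_realize_mod (a : {malg wsum[nat]}) :
  row_map (realize_mod K a) = realize K (row_words a).
Proof.
pose s := flatten [seq [seq rcons w c | w <- enum_fset (msupp a@_c)]
                  | c <- enum_fset (msupp a)].
have -> : row_words a = word_sum s.
  by rewrite /word_sum big_flatten big_map; apply: eq_bigr => c _; rewrite big_map.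
rewrite realize_uniq.
  rewrite big_flatten big_map row_map_sum; apply: eq_bigr => c _.
  rewrite row_mapU mulr_suml big_map; apply: eq_bigr => w _.
  by rewrite sqword_rcons.
apply: allpairs_uniq_dep => [|c _|[c w] [c' w'] _ _ /=]; rewrite ?fset_uniq //.
by case/rcons_inj => -> ->.
Qed.

Lemma mem_row_words (a : {malg wsum[nat]}) v : v \in msupp (row_words a) ->
  exists c w, [/\ c \in msupp a, w \in msupp a@_c & v = rcons w c].
Proof.
rewrite -mcoeff_neq0 raddf_sum /= => nz.
have /hasP[c ca] : has (fun c => has (fun w => v == rcons w c) (enum_fset (msupp a@_c)))
    (enum_fset (msupp a)).
  apply: contraNT nz => /hasPn h; rewrite big_seq big1 // => c /h /hasPn h'.
  rewrite raddf_sum /= big_seq big1 // => w /h'; rewrite mcoeffU eq_sym.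
  by move/negbTE ->.
by move=> /hasP[w wa /eqP ->]; exists c, w.
Qed.

End Rows.

Lemma homog_realize_mod d (a : {malg wsum[nat]}) :
  (forall c w, w \in msupp a@_c -> (0%N \notin w) && (sumn w + c == d)%N) ->
  homog_mod d (realize_mod 'Z_4 a).
Proof.
move=> ha c; rewrite mcoeff_realize_mod; rewrite /realize big_seq.
apply: shifted_homog_sum => w /ha /andP[_ /eqP <-] m.
by move=> /homog_sqword ->.
Qed.

(** * Homogeneous components *)

Lemma homog_cut_subproof K d (s : opalg K) :
  (fun m => if (deg m).+1 == d then s m else 0) \in @op_pred K.
Proof.
apply/op_predP; split=> [|m]; last first.
  by case: ifP => _; [exact: op_dvd2 | exact: dvd2_0].
by have [N hN] := op_bounded s; exists N => m /hN ->; rewrite if_same.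
Qed.

(** The component of degree d - 1, that of a coefficient of e_1; it is 0 when d = 0. *)
Definition homog_cut K d (s : opalg K) : opalg K := Op (homog_cut_subproof d s).

Lemma homog_cutE K d (s : opalg K) m :
  homog_cut d s m = if (deg m).+1 == d then s m else 0.
Proof. by []. Qed.

(** The components of [s] in other degrees contribute to [s * Sq K 1] only outside degree d, where
    the product vanishes. *)
Lemma homog_cut_mul K d (s : opalg K) : homog d (s * Sq K 1) ->
  s * Sq K 1 = homog_cut d s * Sq K 1.
Proof.
move=> h; apply/eqP; rewrite -subr_eq0 -mulrBl; apply/eqP/opalgP => m.
apply/eqP/negPn/negP => nz.
have [m1 [m2 [e n1 /homog_Sq n2]]] := conv_support nz.
have d1 : (deg m1).+1 != d.
  apply: contraNneq n1 => E.
  by rewrite op_subE homog_cutE E eqxx subrr.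
have md : deg m <> d by move=> E; move: d1; rewrite -E -e n2 addn1 eqxx.
move: nz; rewrite mulrBl op_subE.
have -> : (s * Sq K 1) m = 0 by apply/eqP/negPn/negP => /h.
have -> : (homog_cut d s * Sq K 1) m = 0.
  apply/eqP/negPn/negP => /conv_support[p1 [p2 [e' n3 /homog_Sq n4]]].
  move: n3; rewrite homog_cutE.
  by case: (_ =P d) => [E _|_]; [apply: md; rewrite -e' n4 addn1 | rewrite eqxx].
by rewrite subrr eqxx.
Qed.

Lemma columns_gt0 r c : valid_row r -> c \in columns r -> c != 0%N.
Proof.
case: r => [n|n|] /= h; rewrite inE.
- by move/eqP ->; rewrite -lt0n.
- by case/predU1P => [->|/eqP ->] //; rewrite -lt0n (ltn_trans _ h).
by case/orP => [/eqP -> //|/andP[]]; rewrite lt0n.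
Qed.

Theorem proposition2p7 (u : nat -> nat -> D1) (hu : secondary_adem_track u)
    (r : first_row) (hr : valid_row r) (d : nat) :
  (forall (rho : freemod 'F_2) (a : {malg wsum[nat]}),
     row_syzygy (columns r) d rho ->
     word_form (columns r) d rho a ->
     let H := corrected_track u (row_words a) in
     bd H = row_map (realize_mod 'Z_4 a) /\
     first_secondary_cycle (columns r) d (realize_mod 'Z_4 a) H)
  /\
  (1%N \in columns r ->
   forall (rho' : freemod 'F_2) (a : {malg wsum[nat]}),
     homog_mod d rho' ->
     word_form [pred c | (c \in columns r) && (c != 1%N)] d rho' a ->
     (exists z, row_map rho' = z * Sq 'F_2 1) ->
     let is_b_can (b : opalg 'F_2) :=
       (forall m, b m != 0 -> (deg m).+1 = d) /\
       realize 'F_2 (Adm (row_words a)) = b * Sq 'F_2 1 in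
     (exists b, is_b_can b) /\
     forall b, is_b_can b ->
       row_syzygy (columns r) d (rho' + << b *g 1%N >>) /\
       bd (corrected_track u (row_words a)) =
         row_map (realize_mod 'Z_4 a) + admissible_lift (b * Sq 'F_2 1)).
Proof.
(* Stated for any [cols] within the row: (a) uses the whole row, (b) its nonintegral columns. *)
have words cols rho a : {subset cols <= columns r} -> word_form cols d rho a ->
    forall w, w \in msupp (row_words a) ->
    [/\ 0%N \notin w, sumn w = d & last 0%N w \in cols].
  move=> hc [ha hw _] v /mem_row_words[c [w [ca wa ->]]].
  have /andP[w0 /eqP sw] := hw c w wa; have cc := ha c ca.
  rewrite mem_rcons inE negb_or w0 andbT eq_sym last_rcons sumn_rcons.
  by split=> //; apply: columns_gt0 hr (hc _ cc).
split=> [rho a [_ _ rho0] wf H|c1 rho' a hom wf [z zE] is_b_can].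
  have hx := words _ _ _ (fun c h => h) wf; have [ha hw aE] := wf.
  have hx0 w : w \in msupp (row_words a) -> 0%N \notin w by case/hx.
  have A0 : Adm (row_words a) = 0.
    apply: admissible_free; first exact: msupp_Adm.
    by rewrite (realize_Adm hu) // -row_map_realize_mod aE.
  have bE : bd H = row_map (realize_mod 'Z_4 a).
    by rewrite (bd_corrected_track hu) // A0 addr0 row_map_realize_mod.
  split=> //; split=> //.
  - by move=> c /msupp_realize_mod; exact: ha.
  - exact: homog_realize_mod.
  by apply: homog1_corrected_track => // w /hx[].
have sub : {subset [pred c | (c \in columns r) && (c != 1%N)] <= columns r}.
  by move=> c /andP[].
have hx := words _ _ _ sub wf; have [ha hw aE] := wf.
have hx0 w : w \in msupp (row_words a) -> 0%N \notin w by case/hx.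
have rE : realize 'F_2 (Adm (row_words a)) = row_map rho'.
  by rewrite (realize_Adm hu) // -row_map_realize_mod aE.
split.
  (* The given [z] may be inhomogeneous, so its component of degree d - 1 is taken. *)
  exists (homog_cut d z); split.
    move=> m; rewrite homog_cutE.
    by case: (_ =P d) => // _; rewrite eqxx.
  rewrite rE zE; apply: homog_cut_mul; rewrite -zE.
  by apply/homogE; apply: row_map_homog.
move=> b [hb bE]; split; first split.
- move=> c; rewrite -mcoeff_neq0 mcoeffD mcoeffU.
  case: (1%N =P c) => [<- //|_]; rewrite mulr0n addr0 mcoeff_neq0 -aE.
  by move=> /msupp_realize_mod /ha /sub.
- move=> c m; rewrite mcoeffD mcoeffU; case: (1%N =P c) => [<-|_]; last first.
    by rewrite mulr0n addr0; exact: hom.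
  rewrite mulr1n op_addE.
  have [->|/hom //] := eqVneq (rho'@_1%N m) 0.
  by rewrite add0r => /hb <-; rewrite addn1.
- by rewrite row_mapD row_mapU -bE rE steenrod_addrr.
have hA := msupp_Adm hx0.
rewrite (admissible_liftE (conj hA bE)) (bd_corrected_track hu) //.
(* Row words end in a column other than 1 and the words of [Adm] in Sq^1, so the lifts add up
   without cancellation. *)
rewrite realize_disjoint ?row_map_realize_mod // => w /hx[_ _ /andP[_ l1]].
by apply: contraNN l1 => /(admissible_last1 hu hA bE) ->.
Qed.
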